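(* Let $K$ be an oriented annular multi-knotoid diagram. The annular Jones polynomial and the universal annular Jones polynomial, defined as $$V(K)=(-A^3)^{-w(K)}\langle K\rangle\quad\text{and}\quad V_U(K)=(-A^3)^{-w(K)}\langle K\rangle_U,$$ where $w(K)$ is the writhe of $K$, $A=\tau^{-1/4}$, $\langle K\rangle$ is the annular bracket polynomial of $K$ and $\langle K\rangle_U$ is the universal annular bracket polynomial of $K$, are isotopy invariants of (oriented) annular multi-knotoids.
   Context: $\mathcal{A}=S^1\times D^1$ is the annulus, viewed as a disc with a hole, with an inner and an outer boundary circle. An annular multi-knotoid diagram is a generic smooth immersion of one interval $[0,1]$ and finitely many (possibly zero) circles in the interior of $\mathcal{A}$ whose only singularities are transversal double points (crossings) with over/under information; the images of $0$ and $1$ (leg and head) are distinct from each other and from the crossings. It is oriented when the interval is oriented from leg to head and each closed component is given an orientation. Annular multi-knotoids are equivalence classes of diagrams under surface isotopies of $\mathcal{A}$ and Reidemeister moves R1, R2, R3 performed away from the endpoints (moving a strand over or under an endpoint is forbidden); invariance under this equivalence is meant by ''isotopy invariant''. The writhe $w(K)$ is the number of positive crossings minus the number of negative crossings (usual right-hand rule signs). The trivial knotoid is an embedded interval. The A-smoothing of a crossing replaces it by two disjoint arcs so as to merge the two regions swept when the overstrand is rotated counterclockwise towards the understrand; the B-smoothing is the other one. A state (all crossings smoothed) consists of a trivial knotoid and disjoint simple closed curves: null-homotopic circles (bounding a disc not containing the trivial knotoid), $m$ non-essential circles enclosing the trivial knotoid (bounding a disc containing it), $n$ inner essential circles (between the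 inner boundary and the trivial knotoid), and $l$ outer essential circles (enclosing all the rest). The annular bracket polynomial $\langle\cdot\rangle\in\mathbb{Z}[A^{\pm1},x,v,t]$ is defined by the rules: (i)-(ii) $\langle D\rangle=A\langle D_A\rangle+A^{-1}\langle D_B\rangle$, where $D_A,D_B$ are obtained by A- and B-smoothing of a crossing; (iii) $\langle L\sqcup\mathrm{O}^k\rangle=d^k\langle L\rangle$, where $d=-A^2-A^{-2}$ and $\mathrm{O}^k$ stands for $k$ null-homotopic circles; (iv) a state without null-homotopic circles, having $n$ inner essential circles, $m$ non-essential circles enclosing the trivial knotoid and $l$ outer essential circles, has value $x^nv^mt^l$ times the bracket of the trivial knotoid; (v) the trivial knotoid has value $1$. The universal annular bracket $\langle\cdot\rangle_U\in\mathbb{Z}[A^{\pm1},x_n,v_m,t_l: n,m,l\ge0]$ is defined by the same rules with $x^nv^mt^l$ in (iv) replaced by $x_nv_mt_l$ ($x_0=v_0=t_0=1$). *)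

(* Defs.v *)
From HB Require Import structures.
From mathcomp Require Import all_boot all_order all_algebra.
From mathcomp Require Import fingroup perm fraction.
From mathcomp.multinomials Require Import monalg.
From Stdlib Require Import Relation_Operators.

Set Implicit Arguments.
Unset Strict Implicit.
Unset Printing Implicit Defensive.

Import GRing.Theory.
Local Open Scope ring_scope.

(* Diagrams on the annulus, up to surface isotopy, as graphs drawn on the     *)
(* sphere obtained by capping off the two boundary circles.  The vertices are *)
(* the two endpoints of the interval (valency 1), the crossings (valency 4)   *)
(* and auxiliary plain points of the strands (valency 2), the latter so that  *)
(* a circle without crossings is also made of edges.  A dart is an edge       *)
(* together with one of its ends; [edge] exchanges the ends of an edge and    *)
(* [turn] is the counterclockwise rotation around a vertex.  [reg d] is the   *)
(* region of the complement containing the corner swept from [d] to           *)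
(* [turn d]; a region may be met by several components of the drawing.        *)
(* [inner] and [outer] are the regions adjacent to the inner and the outer    *)
(* boundary circle.  [over] tells the darts of the overstrand and is          *)
(* meaningful at crossings only.                                              *)
Record diagram := Diagram {
  dart : finType;
  region : finType;
  edge : dart -> dart;
  turn : dart -> dart;
  over : dart -> bool;
  reg : dart -> region;
  inner : region;
  outer : region
}.

Definition endpoint (D : diagram) (d : dart D) : bool := turn d == d.

(* valency 4, given that the valencies divide 4 *)
Definition crossing (D : diagram) (d : dart D) : bool := turn (turn d) != d.

Definition vertex (D : diagram) (d : dart D) : seq (dart D) :=
  [:: d; turn d; turn (turn d); iter 3 (@turn D) d].

Definition joined (D : diagram) : rel (dart D) :=
  [rel d e | (e == edge d) || (e == turn d)].

(* The face condition: the corner d and the corner edge (turn d) are on the   *)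
(* same side of the edge of turn d.  Euler: V - E + F = 1 + (number of        *)
(* components of the graph); for a surface cut into regions in a connected    *)
(* way, it characterizes the sphere with planar regions.                      *)
Definition annular (D : diagram) : Prop :=
  [/\ [/\ involutive (@edge D),
          (forall d : dart D, edge d != d),
          (forall d : dart D, iter 4 (@turn D) d = d)
        & #|[set d : dart D | endpoint d]| = 2],
      (forall d : dart D, crossing d -> over (turn d) = ~~ over d),
      [/\ (forall d : dart D, reg (edge (turn d)) = reg d),
          inner D \in codom (@reg D)
        & outer D \in codom (@reg D)],
      (forall d e : dart D,
         connect [rel d e | joined d e || (reg d == reg e)] d e)
    & (fcard (@turn D) predT + #|codom (@reg D)|
       = #|dart D|./2 + n_comp (@joined D) predT + 1)%N].

Definition merge (T : eqType) (r1 r2 : T) (r : T) : T :=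
  if r == r2 then r1 else r.

(* The smoothing which merges the regions at the corner c of a crossing and   *)
(* at the opposite corner: the two resulting arcs, each through a plain       *)
(* point, join turn c to turn (turn c), and the third rotation of c to c.     *)
(* Rotating an overstrand dart counterclockwise sweeps the corner it starts,  *)
(* so this is the A-smoothing when c is over and the B-smoothing when c is    *)
(* under.                                                                     *)
Definition smooth (D : diagram) (c : dart D) : diagram :=
  let opp := turn (turn c) in
  @Diagram (dart D) (region D) (@edge D)
    (fun d => if d \in [:: c; opp] then iter 3 (@turn D) d else turn d)
    (@over D)
    (fun d => merge (reg c) (reg opp) (reg d))
    (merge (reg c) (reg opp) (inner D))
    (merge (reg c) (reg opp) (outer D)).

Definition component (D : diagram) (d : dart D) : {set dart D} :=
  [set e | connect (@joined D) d e].

Definition circles (D : diagram) : {set {set dart D}} :=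
  [set component d | d : dart D & [forall e in component d, ~~ endpoint e]].

(* The set S of regions of a state is one side of the circle C: at a point    *)
(* of the strands, the two sides of the strand are separated by S iff the     *)
(* point is on C.                                                             *)
Definition bounds (D : diagram) (C : {set dart D}) (S : {set region D}) :=
  [forall d, (reg d \in S) (+) (reg (turn d) \in S) == (d \in C)].

Definition has_knotoid (D : diagram) (S : {set region D}) : bool :=
  [exists d : dart D, endpoint d && (reg d \in S)].

(* A side of C without the two boundary circles is a disc of the annulus; a   *)
(* side with the inner circle only is the annulus between it and C.           *)
Definition null_homotopic (D : diagram) (C : {set dart D}) : bool :=
  [exists S : {set region D}, [&& bounds C S, inner D \notin S,
     outer D \notin S & ~~ has_knotoid S]].

Definition enclosing (D : diagram) (C : {set dart D}) : bool :=
  [exists S : {set region D}, [&& bounds C S, inner D \notin S,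
     outer D \notin S & has_knotoid S]].

Definition inner_essential (D : diagram) (C : {set dart D}) : bool :=
  [exists S : {set region D}, [&& bounds C S, inner D \in S,
     outer D \notin S & ~~ has_knotoid S]].

Definition outer_essential (D : diagram) (C : {set dart D}) : bool :=
  [exists S : {set region D}, [&& bounds C S, inner D \in S,
     outer D \notin S & has_knotoid S]].

(* The Laurent polynomials in tau^(1/4), inside their field of fractions.     *)
Definition Laurent := {fraction {poly int}}.
Definition tau_quarter : Laurent := tofrac 'X.
Definition A : Laurent := tau_quarter^-1.
Definition d_loop : Laurent := - A ^+ 2 - A ^- 2.

Section Bracket.

(* [val n m l] is the value of a state with n inner essential, m enclosing    *)
(* and l outer essential circles, and no null-homotopic one.                  *)
Variables (B : lmodType Laurent) (val : nat -> nat -> nat -> B).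

Definition state_value (D : diagram) : B :=
  d_loop ^+ #|[set C in circles D | null_homotopic C]| *:
    val #|[set C in circles D | inner_essential C]|
        #|[set C in circles D | enclosing C]|
        #|[set C in circles D | outer_essential C]|.

Fixpoint bracket_rec (fuel : nat) (D : diagram) : B :=
  if fuel isn't k.+1 then state_value D else
  if [pick c : dart D | crossing c && over c] is Some c
  then A *: bracket_rec k (smooth c) + A^-1 *: bracket_rec k (smooth (turn c))
  else state_value D.

(* The choice of the crossing is irrelevant: see [Skein.bracket_skein].       *)
Definition bracket (D : diagram) : B := bracket_rec #|dart D| D.

End Bracket.

(* Rules (i) and (ii) hold at every crossing, not only at the picked one.     *)
Module Skein.
Section FixedDarts.
Lemma merge_eq (T : eqType) (a b x y : T) :
  (merge a b x == merge a b y)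
  = (x == y) || (x \in [:: a; b]) && (y \in [:: a; b]).
Proof.
rewrite /merge !inE.
case: (eqVneq x b) => [->|nxb]; case: (eqVneq y b) => [->|nyb] //=;
  rewrite ?eqxx ?orbT ?orbF ?(negPf nxb) ?(negPf nyb) ?andbT //=.
by case: (eqVneq x a) => [->|nxa]; case: (eqVneq y a); rewrite ?orbF.
Qed.

Lemma merge_comm (T : eqType) (a b c d x y : T) :
  let m1 := merge a b in let m2 := merge c d in
  (merge (m1 c) (m1 d) (m1 x) == merge (m1 c) (m1 d) (m1 y))
  = (merge (m2 a) (m2 b) (m2 x) == merge (m2 a) (m2 b) (m2 y)).
Proof.
rewrite /= !merge_eq !inE !merge_eq !inE.
by do ![case: eqP => ?; subst => //=].
Qed.

Variables (T R : finType) (e : T -> T) (o : T -> bool).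
Implicit Types (t : T -> T) (g : T -> R) (i j : R).

(* the same diagram but for the names of the regions *)
Definition same t1 g1 i1 j1 t2 g2 i2 j2 : Prop :=
  [/\ t1 =1 t2, (forall d f, (g1 d == g1 f) = (g2 d == g2 f)),
      [/\ i1 \in codom g1, i2 \in codom g2, j1 \in codom g1
        & j2 \in codom g2],
      (forall d, (i1 == g1 d) = (i2 == g2 d))
    & (forall d, (j1 == g1 d) = (j2 == g2 d))].

Local Notation mk t g i j := (@Diagram T R e t o g i j).

Lemma codom_merge g i a b :
  i \in codom g -> merge a b i \in codom (fun d => merge a b (g d)).
Proof. by case/codomP=> d ->; apply: codom_f. Qed.

Lemma same_smooth c t1 g1 i1 j1 t2 g2 i2 j2 :
  same t1 g1 i1 j1 t2 g2 i2 j2 ->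
  let D1 := @smooth (mk t1 g1 i1 j1) c in
  let D2 := @smooth (mk t2 g2 i2 j2) c in
  same (@turn D1) (@reg D1) (inner D1) (outer D1)
       (@turn D2) (@reg D2) (inner D2) (outer D2).
Proof.
case=> tE gE [c1 c2 c3 c4] iE jE /=; split=> /=.
- by move=> d /=; rewrite -!tE.
- by move=> d f; rewrite !merge_eq !inE -!tE !gE.
- by split; apply: codom_merge.
- by move=> d; rewrite !merge_eq !inE -!tE !gE !iE.
- by move=> d; rewrite !merge_eq !inE -!tE !gE !jE.
Qed.

Lemma same_side t1 g1 i1 j1 t2 g2 i2 j2 (C S1 : {set _}) :
  same t1 g1 i1 j1 t2 g2 i2 j2 -> @bounds (mk t1 g1 i1 j1) C S1 ->
  exists S2, [/\ @bounds (mk t2 g2 i2 j2) C S2, (i2 \in S2) = (i1 \in S1),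
    (j2 \in S2) = (j1 \in S1)
    & @has_knotoid (mk t2 g2 i2 j2) S2 = @has_knotoid (mk t1 g1 i1 j1) S1].
Proof.
case=> tE gE [c1 c2 c3 c4] iE jE /forallP h1.
pose S2 := [set g2 d | d : T & g1 d \in S1].
have memS d : (g2 d \in S2) = (g1 d \in S1).
  apply/imsetP/idP=> [[f]|h]; last by exists d => //; rewrite inE.
  by rewrite inE => h /eqP; rewrite -gE => /eqP ->.
exists S2; split.
- by apply/forallP=> d; rewrite /= !memS -tE; apply: h1.
- have /codomP[d dE] := c2; have := iE d; rewrite dE eqxx => /eqP dE'.
  by rewrite memS -dE'.
- have /codomP[d dE] := c4; have := jE d; rewrite dE eqxx => /eqP dE'.
  by rewrite memS -dE'.
- by apply: eq_existsb => d; rewrite /= memS /endpoint /= tE.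
Qed.

Lemma same_sym t1 g1 i1 j1 t2 g2 i2 j2 :
  same t1 g1 i1 j1 t2 g2 i2 j2 -> same t2 g2 i2 j2 t1 g1 i1 j1.
Proof.
case=> tE gE [c1 c2 c3 c4] iE jE; split; first by move=> d; rewrite tE.
- by move=> d f; rewrite gE.
- by split.
- by move=> d; rewrite iE.
- by move=> d; rewrite jE.
Qed.

Lemma same_circle t1 g1 i1 j1 t2 g2 i2 j2 (C : {set T}) :
  same t1 g1 i1 j1 t2 g2 i2 j2 ->
  [/\ @null_homotopic (mk t1 g1 i1 j1) C = @null_homotopic (mk t2 g2 i2 j2) C,
      @enclosing (mk t1 g1 i1 j1) C = @enclosing (mk t2 g2 i2 j2) C,
      @inner_essential (mk t1 g1 i1 j1) C
        = @inner_essential (mk t2 g2 i2 j2) C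
    & @outer_essential (mk t1 g1 i1 j1) C
        = @outer_essential (mk t2 g2 i2 j2) C].
Proof.
move=> sm; have sm' := same_sym sm.
by split; apply/existsP/existsP=> -[S /and4P[hb]];
  first [have [S2 [hb2 /= <- <- <-]] := same_side sm hb
        |have [S2 [hb2 /= <- <- <-]] := same_side sm' hb];
  move=> h2 h3 h4; exists S2; apply/and4P.
Qed.

Variables (B : lmodType Laurent) (val : nat -> nat -> nat -> B).

Lemma same_value t1 g1 i1 j1 t2 g2 i2 j2 :
  same t1 g1 i1 j1 t2 g2 i2 j2 ->
  state_value val (mk t1 g1 i1 j1) = state_value val (mk t2 g2 i2 j2).
Proof.
move=> sm; have [tE _ _ _ _] := sm.
have compE d : @component (mk t1 g1 i1 j1) d = @component (mk t2 g2 i2 j2) d.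
  apply/setP=> f; rewrite !inE; apply: eq_connect => x y.
  by rewrite /joined /= tE.
have circE : circles (mk t1 g1 i1 j1) = circles (mk t2 g2 i2 j2).
  rewrite /circles; apply/setP=> C.
  by apply/imsetP/imsetP => -[d]; rewrite inE => /forallP h ->; exists d;
    rewrite // inE; apply/forallP=> f; move: (h f);
    rewrite compE /endpoint /= tE.
rewrite /state_value circE.
congr (_ ^+ _ *: val _ _ _); apply: eq_card => C; rewrite !inE;
  by have [nE eE iE oE] := same_circle C sm; rewrite ?nE ?eE ?iE ?oE.
Qed.

Lemma same_rec n t1 g1 i1 j1 t2 g2 i2 j2 :
  same t1 g1 i1 j1 t2 g2 i2 j2 ->
  bracket_rec val n (mk t1 g1 i1 j1) = bracket_rec val n (mk t2 g2 i2 j2).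
Proof.
elim: n t1 g1 i1 j1 t2 g2 i2 j2 => [|n IH] t1 g1 i1 j1 t2 g2 i2 j2 sm /=.
  exact: same_value.
have [tE _ _ _ _] := sm.
rewrite (@eq_pick _ _ (fun c => @crossing (mk t2 g2 i2 j2) c && o c)); last first.
  by move=> c; rewrite /= /crossing /= !tE.
case: pickP => [c _|_]; last exact: same_value.
congr (_ *: _ + _ *: _); first exact: IH (same_smooth c sm).
suff <- : t1 c = t2 c by exact: IH (same_smooth (t1 c) sm).
exact: tE.
Qed.

(* what is needed of a diagram, preserved by smoothings *)
Definition sane t g i j := [/\ (forall d, t (t (t (t d))) = d),
  (forall d, t (t d) != d -> o (t d) = ~~ o d), i \in codom g & j \in codom g].

Definition orb t c := [:: c; t c; t (t c); t (t (t c))].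
Definition st t c d := if d \in [:: c; t (t c)] then t (t (t d)) else t d.

Section Turn.
Variables (t : T -> T).
Hypothesis t4 : forall d, t (t (t (t d))) = d.

Lemma turn_inj : injective t. Proof. exact: (can_inj (g := fun d => t (t (t d))) t4). Qed.

Lemma orb_turn c d : (t d \in orb t c) = (d \in orb t c).
Proof.
by rewrite /orb !inE !(inj_eq turn_inj) -[in t d == c](t4 c) (inj_eq turn_inj) orbC -!orbA.
Qed.

Lemma orb_sym c d : (d \in orb t c) = (c \in orb t d).
Proof.
by rewrite /orb !inE; apply/idP/idP => /or4P[] /eqP ->; rewrite ?t4 ?eqxx ?orbT.
Qed.

Lemma st_out c d : d \notin orb t c -> st t c d = t d.
Proof. by rewrite /st /orb !inE !negb_or => /and4P[/negPf -> _ /negPf -> _]. Qed.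

Lemma st_in c d : t (t c) != c -> d \in orb t c -> st t c (st t c d) = d.
Proof.
move=> hc; have n1 : t c != c by apply: contraNneq hc => h; rewrite !h.
have n3 : t (t (t c)) != c.
  by apply: contraNneq n1 => h; rewrite -[in X in t X]h t4.
have n12 : (t c == t (t c)) = false by rewrite (inj_eq turn_inj) eq_sym (negPf n1).
have n32 : (t (t (t c)) == t (t c)) = false.
  by rewrite !(inj_eq turn_inj) (negPf n1).
move/negPf in n1; move/negPf in n3.
by rewrite /st /orb !inE => /or4P[] /eqP ->;
  rewrite ?eqxx ?orbT /= ?t4 ?n1 ?n3 ?n12 ?n32 ?eqxx ?orbT //= ?t4.
Qed.

Lemma st_cross c d : t (t c) != c ->
  (st t c (st t c d) != d) = (t (t d) != d) && (d \notin orb t c).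
Proof.
move=> hc; case hd: (d \in orb t c); first by rewrite st_in // eqxx andbF.
by rewrite (st_out (d := d)) ?hd // st_out ?orb_turn ?hd // andbT.
Qed.

Lemma st4 c d : t (t c) != c -> st t c (st t c (st t c (st t c d))) = d.
Proof.
move=> hc; case hd: (d \in orb t c); first by rewrite !(st_in hc).
by do 4!rewrite st_out ?orb_turn ?hd //.
Qed.

Lemma cross_orb c d : t (t c) != c -> d \in orb t c -> t (t d) != d.
Proof.
by move=> hc; rewrite /orb !inE => /or4P[] /eqP ->; rewrite ?(inj_eq turn_inj).
Qed.

Lemma orb_trans c c' d : d \in orb t c' -> (d \in orb t c) = (c' \in orb t c).
Proof.
have orbP : reflect (exists k : 'I_4, d = iter k t c') (d \in orb t c').
  rewrite /orb !inE; apply: (iffP or4P) => [[]/eqP->|[[[|[|[|[|//]]]] ?] /= ->]].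
  - by exists 0.
  - by exists 1.
  - by exists (Ordinal (isT : 2 < 4)%N).
  - by exists (Ordinal (isT : 3 < 4)%N).
  - by constructor 1.
  - by constructor 2.
  - by constructor 3.
  - by constructor 4.
case/orbP=> k ->; elim: (nat_of_ord k) => // n IH.
by rewrite [iter _ _ _]/= orb_turn IH.
Qed.

Lemma orb_opp x y : y \in [:: x; t (t x)] -> y \in orb t x.
Proof. by rewrite /orb !inE => /orP[] ->; rewrite ?orbT. Qed.

Lemma st_comm c c' d : c' \notin orb t c ->
  st (st t c) c' d = st (st t c') c d.
Proof.
have half x y f : y \notin orb t x -> f \notin orb t x ->
    st (st t x) y f = st t y f /\ st (st t y) x f = st t y f.
  move=> hy hf; have hx : x \notin orb t y by rewrite orb_sym.
  have e1 : st t x y = t y by exact: st_out.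
  have e2 : st t x (t y) = t (t y) by apply: st_out; rewrite orb_turn.
  have e3 : st t y x = t x by exact: st_out.
  have e4 : st t y (t x) = t (t x) by apply: st_out; rewrite orb_turn.
  split; rewrite [LHS]/st !(e1, e2, e3, e4).
    by rewrite !(st_out (c := x)) ?orb_turn.
  by case: ifP => // /orb_opp h; move: hf; rewrite h.
move=> hc'; have hc : c \notin orb t c' by rewrite orb_sym.
case hd: (d \in orb t c); last first.
  by have [-> ->] := half _ _ _ hc' (negbT hd).
have hd' : d \notin orb t c'.
  by apply: contraNN hc' => h; rewrite -(orb_trans _ h).
by have [-> ->] := half _ _ _ hc hd'.
Qed.

End Turn.

Local Notation sm t g i j c := (@smooth (mk t g i j) c).

Lemma sane_smooth t g i j c : sane t g i j -> t (t c) != c ->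
  sane (st t c) (fun d => merge (g c) (g (t (t c))) (g d))
    (merge (g c) (g (t (t c))) i) (merge (g c) (g (t (t c))) j).
Proof.
case=> t4 to ci cj hc; split; try exact: codom_merge.
  by move=> d; apply: st4.
move=> d; rewrite st_cross // => /andP[hd hd'].
by rewrite (st_out hd') to.
Qed.

Definition ncross t := #|[pred d | (t (t d) != d) && o d]|.

Lemma ncross_smooth t g i j c c' : sane t g i j -> t (t c) != c -> o c ->
  c' \in [:: c; t c] -> (ncross (st t c') < ncross t)%N.
Proof.
case=> t4 to _ _ hc oc hc'.
have hcc' : c' \in orb t c by rewrite /orb; move: hc'; rewrite !inE orbA => ->.
have h' := cross_orb t4 hc hcc'.
apply: proper_card; apply/properP; split.
  by apply/subsetP=> d; rewrite !inE st_cross // -andbA => /and3P[-> _ ->].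
exists c; rewrite !inE ?hc // st_cross // (orb_sym t4) hcc'.
by rewrite andbF.
Qed.

Lemma same_comm t g i j c c' : sane t g i j -> c' \notin orb t c ->
  let D1 := @smooth (sm t g i j c) c' in
  let D2 := @smooth (sm t g i j c') c in
  same (@turn D1) (@reg D1) (inner D1) (outer D1)
       (@turn D2) (@reg D2) (inner D2) (outer D2).
Proof.
case=> t4 to ci cj hc'; have hc : c \notin orb t c' by rewrite orb_sym.
have e1 : st t c (st t c c') = t (t c') by rewrite !st_out ?orb_turn.
have e2 : st t c' (st t c' c) = t (t c) by rewrite !st_out ?orb_turn.
pose m1 := merge (g c) (g (t (t c))); pose m2 := merge (g c') (g (t (t c'))).
suff : same (st (st t c) c')
    (fun d => merge (m1 (g c')) (m1 (g (st t c (st t c c')))) (m1 (g d)))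
    (merge (m1 (g c')) (m1 (g (st t c (st t c c')))) (m1 i))
    (merge (m1 (g c')) (m1 (g (st t c (st t c c')))) (m1 j))
    (st (st t c') c)
    (fun d => merge (m2 (g c)) (m2 (g (st t c' (st t c' c)))) (m2 (g d)))
    (merge (m2 (g c)) (m2 (g (st t c' (st t c' c)))) (m2 i))
    (merge (m2 (g c)) (m2 (g (st t c' (st t c' c)))) (m2 j)) by [].
rewrite e1 e2; split.
- by move=> d; apply: st_comm.
- by move=> d f; apply: merge_comm.
- have [[x ->] [y ->]] := (codomP ci, codomP cj).
  by split; apply/codomP; first [by exists x | by exists y].
- by move=> d; apply: merge_comm.
- by move=> d; apply: merge_comm.
Qed.

Lemma same_opp t g i j c : sane t g i j -> t (t c) != c ->
  let D1 := sm t g i j (t (t c)) in let D2 := sm t g i j c in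
  same (@turn D1) (@reg D1) (inner D1) (outer D1)
       (@turn D2) (@reg D2) (inner D2) (outer D2).
Proof.
case=> t4 to ci cj hc; rewrite /= t4; split.
- by move=> d; rewrite !inE orbC.
- by move=> d f; rewrite !merge_eq !inE ![_ || (_ == g (t (t c)))]orbC.
- by split; apply: codom_merge.
- by move=> d; rewrite !merge_eq !inE ![_ || (_ == g (t (t c)))]orbC.
- by move=> d; rewrite !merge_eq !inE ![_ || (_ == g (t (t c)))]orbC.
Qed.

Lemma bracket_recS n D : bracket_rec val n.+1 D =
  if [pick c : dart D | crossing c && over c] is Some c
  then A *: bracket_rec val n (smooth c) + A^-1 *: bracket_rec val n (smooth (turn c))
  else state_value val D.
Proof. by []. Qed.

Lemma bracket_rec_skein n t g i j c : sane t g i j -> t (t c) != c -> o c ->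
  (ncross t <= n.+1)%N ->
  bracket_rec val n.+1 (mk t g i j) =
  A *: bracket_rec val n (sm t g i j c)
  + A^-1 *: bracket_rec val n (sm t g i j (t c)).
Proof.
elim: n t g i j c => [|n IH] t g i j c sn hc oc le_n;
  have [t4 to ci cj] := sn; rewrite [LHS]bracket_recS;
  (case: pickP => [c0 /andP[hc0 oc0]|/(_ c)];
    last by rewrite /crossing /= hc oc);
  rewrite /crossing /= in hc0 oc0; have [inc|ninc] := boolP (c0 \in orb t c).
1,3: have hc1 : t (t (t c)) != t c by rewrite (inj_eq (turn_inj t4)).
1,2: have hc2 : t (t (t (t c))) != t (t c) by rewrite (inj_eq (turn_inj t4)).
1,2: have o1 : o (t c) = false by rewrite to ?oc.
1,2: have o3 : o (t (t (t c))) = false by rewrite to // to // o1.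
1,2: move: inc oc0; rewrite /orb !inE => /or4P[] /eqP ->; rewrite ?o1 ?o3 // => _.
1,2: congr (_ *: _ + _ *: _); apply: same_rec;
  [exact: same_opp sn hc | exact: same_opp sn hc1].
all: have cx : st t c0 (st t c0 c) != c by rewrite st_cross // hc (orb_sym t4).
  have := leq_trans (ncross_smooth sn hc0 oc0 (mem_head _ _)) le_n.
  rewrite ltnS leqn0 /ncross => /eqP/card0_eq/(_ c).
  by rewrite !inE cx oc.
have ninc1 : t c0 \notin orb t c by rewrite orb_turn.
have ninc' : c \notin orb t c0 by rewrite (orb_sym t4).
have b c1 c2 : t (t c1) != c1 -> o c1 -> c2 \in [:: c1; t c1] ->
    (ncross (st t c2) <= n.+1)%N.
  by move=> h1 h2 h3; have := leq_trans (ncross_smooth sn h1 h2 h3) le_n.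
have tc0 : t (t (t c0)) != t c0 by rewrite (inj_eq (turn_inj t4)).
have tc : t (t (t c)) != t c by rewrite (inj_eq (turn_inj t4)).
have xx c1 c2 : t (t c1) != c1 -> t (t c2) != c2 -> c2 \notin orb t c1 ->
    o c2 -> (ncross (st t c1) <= n.+1)%N ->
    bracket_rec val n.+1 (sm t g i j c1) =
    A *: bracket_rec val n (@smooth (sm t g i j c1) c2)
    + A^-1 *: bracket_rec val n (@smooth (sm t g i j c1) (t c2)).
  move=> h1 h2 h3 h4 h5; have := IH _ _ _ _ c2 (sane_smooth sn h1) _ h4 h5.
  rewrite !st_out ?orb_turn //; exact.
have ninc2 : t c \notin orb t c0 by rewrite orb_turn.
have ninc3 : c \notin orb t (t c0) by rewrite (orb_sym t4).
have ninc4 : c0 \notin orb t (t c) by rewrite (orb_sym t4).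
have h1 : c0 \in [:: c0; t c0] by rewrite mem_head.
have h2 : t c0 \in [:: c0; t c0] by rewrite !inE eqxx orbT.
have h3 : c \in [:: c; t c] by rewrite mem_head.
have h4 : t c \in [:: c; t c] by rewrite !inE eqxx orbT.
have b1 := b _ _ hc0 oc0 h1; have b2 := b _ _ hc0 oc0 h2.
have b3 := b _ _ hc oc h3; have b4 := b _ _ hc oc h4.
rewrite (xx c0 c) // ?(xx (t c0) c) // ?(xx c c0) // ?(xx (t c) c0) //.
rewrite !scalerDr !scalerA [LHS]addrACA [A^-1 * A]mulrC.
congr (_ *: _ + _ *: _ + (_ *: _ + _ *: _)); apply: same_rec.
- exact: same_comm sn ninc'.
- exact: same_comm sn ninc3.
- exact: same_comm sn ninc2.
- by apply: same_comm sn _; rewrite (orb_turn t4).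
Qed.
End FixedDarts.

Lemma bracket_skein (B : lmodType Laurent) (val : nat -> nat -> nat -> B)
    (D : diagram) (c : dart D) :
  annular D -> crossing c -> over c ->
  bracket val D
  = A *: bracket val (smooth c) + A^-1 *: bracket val (smooth (turn c)).
Proof.
case: D c => T R e t o g i j c [[_ _ t4 _] to [_ ci cj] _ _] hc oc.
have sn : sane o t g i j by split.
have stable k m t' g' i' j' : sane o t' g' i' j' -> (ncross o t' <= k)%N ->
    (k <= m)%N ->
    bracket_rec val m (Diagram e t' o g' i' j')
    = bracket_rec val k (Diagram e t' o g' i' j').
  elim: k m t' g' i' j' => [|k IH] [|m] t1 g1 i1 j1 sn1 hk // hm.
    rewrite [LHS]bracket_recS; case: pickP => // x /andP[hx ox].
    move: hk; rewrite leqn0 => /eqP/card0_eq/(_ x); rewrite !inE.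
    by rewrite [t1 (t1 x) != x]hx [o x]ox.
  rewrite !bracket_recS; case: pickP => // x /andP[hx ox].
  have lt y : y \in [:: x; t1 x] -> (ncross o (st t1 y) <= k)%N.
    by move=> hy; have := leq_trans (ncross_smooth sn1 hx ox hy) hk.
  have [t4' _ _ _] := sn1.
  have htx : t1 (t1 (t1 x)) != t1 x by rewrite (inj_eq (turn_inj t4')).
  congr (_ *: _ + _ *: _); apply: IH => //; try exact: sane_smooth.
    exact: lt (mem_head _ _).
  by apply: lt; rewrite !inE eqxx orbT.
rewrite /bracket /=.
have lt0 : (0 < #|T|)%N by apply/card_gt0P; exists c.
have [n nE] : exists n, #|T| = n.+1 by exists #|T|.-1; rewrite prednK.
have le_n : (ncross o t <= n.+1)%N by rewrite -nE max_card.
have lt y : y \in [:: c; t c] -> (ncross o (st t y) <= n)%N.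
  by move=> hy; have := leq_trans (ncross_smooth sn hc oc hy) le_n.
have htc : t (t (t c)) != t c by rewrite (inj_eq (turn_inj t4)).
rewrite nE (bracket_rec_skein e val sn hc oc le_n).
congr (_ *: _ + _ *: _); symmetry; apply: stable => //;
  try exact: sane_smooth.
- exact: lt (mem_head _ _).
- by apply: lt; rewrite !inE eqxx orbT.
Qed.

End Skein.

Definition annular_ring := {malg Laurent[{cmonom 'I_3}]}.

(* x, v and t are the variables of index 0, 1 and 2 *)
Definition var (i : 'I_3) : annular_ring := mkmalgU (ucm i) 1.

Definition annular_bracket : diagram -> annular_ring :=
  bracket (fun n m l =>
    var (inord 0) ^+ n * var (inord 1) ^+ m * var (inord 2) ^+ l).

Definition universal_ring := {malg Laurent[{cmonom ('I_3 * nat)%type}]}.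

Definition uvar (i : 'I_3) (n : nat) : universal_ring :=
  if n is k.+1 then mkmalgU (ucm (i, k)) 1 else 1.

Definition universal_bracket : diagram -> universal_ring :=
  bracket (fun n m l =>
    uvar (inord 0) n * uvar (inord 1) m * uvar (inord 2) l).

(* [fwd d]: the strand leaves the vertex of d along d; the leg is the         *)
(* endpoint whose dart is forward, the head is the other one.                 *)
Record odiagram := ODiagram {
  odiag :> diagram;
  fwd : dart odiag -> bool
}.

Definition straight (D : diagram) (d : dart D) : dart D :=
  if crossing d then turn (turn d) else turn d.

Definition oriented_annular (K : odiagram) : Prop :=
  [/\ annular K,
      (forall d : dart K, fwd (edge d) = ~~ fwd d)
    & (forall d : dart K, ~~ endpoint d -> fwd (straight d) = ~~ fwd d)].

(* Right-hand rule: a crossing is positive when turning its outgoing over     *)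
(* dart counterclockwise by one step gives its outgoing under dart.           *)
Definition writhe (K : odiagram) : int :=
  \sum_(c : dart K | [&& crossing c, over c & fwd c])
     (if fwd (turn c) then 1 else - 1).

Definition jones (K : odiagram) : annular_ring :=
  ((- A ^+ 3) ^ (- writhe K)) *: annular_bracket K.

Definition universal_jones (K : odiagram) : universal_ring :=
  ((- A ^+ 3) ^ (- writhe K)) *: universal_bracket K.

(* Surface isotopy: an isomorphism of these data extends to an orientation    *)
(* preserving homeomorphism of the annulus preserving both boundary circles,  *)
(* hence isotopic to the identity.  Plain points are inserted at will.        *)

Definition isomorphic (K K' : odiagram) : Prop :=
  exists2 phi : dart K -> dart K', bijective phi &
  [/\ [/\ (forall d, phi (edge d) = edge (phi d)),
          (forall d, phi (turn d) = turn (phi d)),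
          (forall d, crossing d -> over (phi d) = over d)
        & (forall d, fwd (phi d) = fwd d)],
      (forall d e, (reg (phi d) == reg (phi e)) = (reg d == reg e)),
      (forall d, (reg (phi d) == inner K') = (reg d == inner K))
    & (forall d, (reg (phi d) == outer K') = (reg d == outer K))].

(* A plain point in the middle of the edge of a; its dart inr false faces a   *)
(* and its dart inr true faces edge a.                                        *)
Definition subdivide (K : odiagram) (a : dart K) : odiagram :=
  @ODiagram
    (@Diagram (dart K + bool)%type (region K)
      (fun d => match d with
        | inl d => if d == a then inr false
                   else if d == edge a then inr true else inl (edge d)
        | inr b => inl (if b then edge a else a) end)
      (fun d => match d with
        | inl d => inl (turn d)
        | inr b => inr (~~ b) end)
      (fun d => if d is inl d then over d else false)
      (fun d => match d with
        | inl d => reg d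
        | inr b => if b then reg a else reg (edge a) end)
      (inner K) (outer K))
    (fun d => match d with
      | inl d => fwd d
      | inr b => if b then fwd a else fwd (edge a) end).

(* A region with the corners s and no other: when s is the boundary of a      *)
(* monogon, bigon or triangle, this is a disc with nothing inside.            *)

Definition empty_region (D : diagram) (s : seq (dart D)) (r : region D) :=
  [/\ (forall d : dart D, (reg d == r) = (d \in s)), inner D != r
    & outer D != r].

(* R1: the loop of the kink at the crossing of l goes from l to turn l and    *)
(* bounds a monogon.  Removing the kink replaces the crossing by two plain    *)
(* points, one for each passage of the strand, and leaves the edges and the   *)
(* orientation as they are.  With w, w1, w2, w3 the darts around a crossing,  *)
(* the strands are {w, w2} and {w1, w3}; the regions on the two sides of the  *)
(* straightened strand are those at the outside darts.                        *)
Definition R1_site (D : diagram) (l : dart D) : Prop :=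
  [/\ crossing l, edge l = turn l & empty_region [:: l] (reg l)].

Definition R1 (K : odiagram) (l : dart K) : odiagram :=
  @ODiagram
    (@Diagram (dart K) (region K) (@edge K)
      (fun d => if d \in vertex l then turn (turn d) else turn d)
      (@over K)
      (fun d => if d == l then reg (turn l)
                else if d == turn l then reg (turn (turn l)) else reg d)
      (inner K) (outer K))
    (@fwd K).

(* R2: p and q are the corners of a bigon, between two distinct crossings,    *)
(* one of whose sides is over, or under, at both.  Its edges join turn p to q *)
(* and turn q to p.  Removing it replaces each crossing by two plain points,  *)
(* one on each strand; the bigon disappears, and the regions opposite to it   *)
(* at p and at q become the one region between the two strands.               *)
Definition R2_site (D : diagram) (p q : dart D) : Prop :=
  [/\ [/\ crossing p, crossing q & q \notin vertex p],
      edge (turn p) = q, edge (turn q) = p, over p = over (turn q)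
    & empty_region [:: p; q] (reg p)].

Definition R2 (K : odiagram) (p q : dart K) : odiagram :=
  let m := merge (reg (turn (turn p))) (reg (turn (turn q))) in
  @ODiagram
    (@Diagram (dart K) (region K) (@edge K)
      (fun d => if d \in vertex p ++ vertex q then turn (turn d) else turn d)
      (@over K)
      (fun d => m (if d \in [:: p; turn p; q; turn q] then reg (turn d)
                   else reg d))
      (m (inner K)) (m (outer K)))
    (@fwd K).

(* R3: p, q, r are the corners of a triangle, between three distinct          *)
(* crossings, with sides from turn p to q, from turn q to r and from turn r   *)
(* to p.  The last condition excludes the alternating triangle; otherwise one *)
(* of the three strands is over the two others and one is under them.         *)
Definition R3_site (D : diagram) (p q r : dart D) : Prop :=
  [/\ [/\ crossing p, crossing q & crossing r],
      [/\ q \notin vertex p, r \notin vertex p & r \notin vertex q],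
      [/\ edge (turn p) = q, edge (turn q) = r & edge (turn r) = p],
      ~~ [&& over (turn p) == over (turn q) & over (turn q) == over (turn r)]
    & empty_region [:: p; q; r] (reg p)].

(* If a strand meets first the crossing with darts x, x1, x2, x3 (entering by *)
(* x3 and leaving by x1 along a side of the triangle) and then the crossing   *)
(* with darts y, y1, y2, y3 (entering by y and leaving by y2), the roles of   *)
(* x3 and y, and of x1 and y2, are exchanged.                                 *)
Definition R3_swap (D : diagram) (p q r : dart D) : {perm dart D} :=
  let side x y :=
    (tperm (iter 3 (@turn D) x) y * tperm (turn x) (turn (turn y)))%g in
  (side p q * side q r * side r p)%g.

(* After the move, the triangle is at the corners turn (turn _); the three    *)
(* other corners of the crossing of x are in the regions which were beyond    *)
(* the opposite side of the triangle and at the two other crossings.          *)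
Definition R3 (K : odiagram) (p q r : dart K) : odiagram :=
  let sw := R3_swap p q r in
  let at_vertex x y z d e :=
    if d == x then reg (turn y)
    else if d == turn x then reg (turn (turn y))
    else if d == turn (turn x) then reg x
    else if d == iter 3 (@turn K) x then reg (turn (turn z))
    else e in
  @ODiagram
    (@Diagram (dart K) (region K)
      (fun d => sw (edge (sw d)))
      (@turn K) (@over K)
      (fun d => at_vertex p q r d (at_vertex q r p d (at_vertex r p q d
                  (reg d))))
      (inner K) (outer K))
    (@fwd K).

Inductive move (K : odiagram) : odiagram -> Prop :=
| MoveIso K' : isomorphic K K' -> move K K'
| MoveSubdivide a : move K (subdivide (K := K) a)
| MoveR1 l : R1_site (D := K) l -> move K (R1 l)
| MoveR2 p q : R2_site (D := K) p q -> move K (R2 p q)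
| MoveR3 p q r : R3_site (D := K) p q r -> move K (R3 p q r).

Definition step (K K' : odiagram) : Prop :=
  [/\ oriented_annular K, oriented_annular K' & move K K'].

(* Two oriented diagrams represent the same annular multi-knotoid.            *)
Definition annular_equivalent : odiagram -> odiagram -> Prop :=
  clos_refl_sym_trans odiagram step.

(* Main.v *)
(* The writhe cancels the factor (-A^3)^(+-1) by which removing a kink changes the
   bracket, so it suffices to prove that the bracket is invariant under R2 and R3
   and to compute its change under R1.  By the skein relation, the bracket near a
   move is a combination of brackets of local states without crossings in a disc.
   The bracket only depends on how such a state joins the ends of the strands on
   the boundary of the disc and on its number of null-homotopic circles, which each
   give a factor d: this is shown by induction on the crossings outside of the
   disc, until a comparison of states is left, in which corresponding circles have
   corresponding sides.  Each move is then an identity between Laurent polynomials,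
   resting on A^2 + A^-2 + d = 0. *)

From mathcomp Require Import all_boot all_algebra.
From mathcomp Require Import fingroup perm fraction ring.
From mathcomp.multinomials Require Import monalg.
Require Import Defs.

Set Implicit Arguments.
Unset Strict Implicit.
Unset Printing Implicit Defensive.

Import GRing.Theory.
Local Open Scope ring_scope.

(** A smoothing keeps the type of regions and identifies two of them by [merge], and the empty
    region of a move may disappear; so the names of regions are not canonical. How a local state
    joins the ends is left to evaluation: the darts at the vertices of a move are numbered, and each
    comparison of two local states is one run of the boolean [check]. For R3 all three crossings are
    expanded, instead of one followed by R2. This gives a formula which treats the triangles before
    and after the move alike. *)

(* A weakening of [annular] which is stable under smoothing; the last clause is the
   connectedness of the surface. *)
Definition good (D : diagram) : Prop :=
  [/\ involutive (@edge D),
      (forall d : dart D, turn (turn (turn (turn d))) = d),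
      (forall d : dart D, crossing d -> over (turn d) = ~~ over d),
      (forall d : dart D, reg (edge (turn d)) = reg d) /\
      (inner D \in codom (@reg D) /\ outer D \in codom (@reg D))
    & forall f : dart D -> bool,
        (forall d, f (edge d) = f d) -> (forall d, f (turn d) = f d) ->
        (forall d e, reg d = reg e -> f d = f e) -> forall d e, f d = f e].

Lemma annular_good (D : diagram) : annular D -> good D.
Proof.
case=> [[eK _ t4 _] oE [fE iE jE] con _]; split=> // f fe ft fr d e.
have /connectP[s sP ->] := con d e.
elim: s d sP => //= x s IH d /andP[dx sP]; rewrite -(IH x sP).
case/orP: dx => [/orP[]|] /eqP dx; first by rewrite dx fe.
- by rewrite dx ft.
- exact: fr dx.
Qed.

Section Good.
Variables (D : diagram).
Hypothesis gD : good D.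

Lemma turn4 (d : dart D) : turn (turn (turn (turn d))) = d.
Proof. by case: gD. Qed.

Lemma turn_injective : injective (@turn D).
Proof. exact: (can_inj (g := fun d => turn (turn (turn d))) turn4). Qed.

Lemma crossing_turn (d : dart D) : crossing (turn d) = crossing d.
Proof. by rewrite /crossing (inj_eq turn_injective). Qed.

Lemma sane_of : Skein.sane (@over D) (@turn D) (@reg D) (inner D) (outer D).
Proof. by case: gD => ? ? ? [? [? ?]] ?. Qed.

Lemma good_smooth (c : dart D) : crossing c -> good (smooth c).
Proof.
move=> hc; have [eK t4 oE [fE [iE jE]] con] := gD.
have [t4' oE' iE' jE'] := Skein.sane_smooth sane_of hc.
have tI := turn_injective.
split=> //.
- split=> // d /=; rewrite !inE.
  case: (eqVneq d c) => [-> | nc] /=.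
    by rewrite fE /merge eqxx; case: eqP.
  case: (eqVneq d (turn (turn c))) => [-> | nc'] /=.
    by rewrite t4 -[in edge (turn c)](t4 (turn c)) fE t4 /merge eqxx; case: eqP.
  by rewrite fE.
- move=> f fe ft fr; apply: con => // d; last first.
    by move=> e de; apply: fr; rewrite /= de.
  (* The smoothing splits the four darts into two pairs, which the merged region of [c] and
     [turn (turn c)] links again. *)
  have f2 : f (turn (turn c)) = f c.
    by apply: fr; rewrite /= /merge eqxx; case: eqP.
  have hc1 : turn c \in [:: c; turn (turn c)] = false.
    rewrite !inE (inj_eq tI) [c == _]eq_sym orbb; apply: contraNF hc => /eqP h.
    by rewrite h h.
  case: (eqVneq d c) => [->|nc].
    by have := ft (turn c); rewrite /= hc1 f2.
  case: (eqVneq d (turn (turn c))) => [->|nc'].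
    by have := ft c; rewrite /= !inE eqxx f2.
  by have := ft d; rewrite /= !inE (negPf nc) (negPf nc').
Qed.

End Good.

(** * The skein relation at any dart of a crossing *)

Section SkeinRelation.
Variables (B : lmodType Laurent) (val : nat -> nat -> nat -> B).

Notation ncross D := (Skein.ncross (@over D) (@turn D)).

(** In the skein relation the smoothings are evaluated with one unit of fuel less than in their own
    [bracket]. Fuel beyond the number of over darts at crossings changes nothing, as each smoothing
    lowers that number. *)
Lemma bracket_rec_stable k m (D : diagram) : good D ->
  (ncross D <= k)%N -> (k <= m)%N -> bracket_rec val m D = bracket_rec val k D.
Proof.
elim: k m D => [|k IH] [|m] D gD hk // hm.
  rewrite Skein.bracket_recS; case: pickP => // x /andP[hx ox].
  move: hk; rewrite leqn0 => /eqP/card0_eq/(_ x); rewrite !inE.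
  by rewrite [turn (turn x) != x]hx ox.
rewrite !Skein.bracket_recS; case: pickP => // x /andP[hx ox].
have lt (y : dart D) : y \in [:: x; turn x] -> (ncross (smooth y) <= k)%N.
  move=> hy; rewrite -ltnS; apply: leq_trans hk.
  exact: Skein.ncross_smooth (sane_of gD) hx ox hy.
have hx' : crossing (turn x) by rewrite crossing_turn.
by congr (_ *: _ + _ *: _); apply: IH => //;
  do ?[exact: good_smooth | apply: lt; rewrite !inE eqxx ?orbT].
Qed.

(** Reading the skein relation from an under dart exchanges the A- and B-smoothings, so the
    coefficient is attached to the dart. The moves can then be treated without distinguishing which
    strand is over. *)
Definition weight (D : diagram) (c : dart D) : Laurent :=
  if over c then A else A^-1.

Lemma A_neq0 : A != 0.
Proof. by rewrite invr_eq0 tofrac_eq0 polyX_eq0. Qed.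

Lemma skein_over (D : diagram) (c : dart D) : good D -> crossing c -> over c ->
  bracket val D
  = A *: bracket val (smooth c) + A^-1 *: bracket val (smooth (turn c)).
Proof.
move=> gD hc oc.
have [n nE] : exists n, #|dart D| = n.+1.
  by exists #|dart D|.-1; rewrite prednK //; apply/card_gt0P; exists c.
have le_n : (ncross D <= n.+1)%N by rewrite -nE max_card.
have hc' : crossing (turn c) by rewrite crossing_turn.
have lt (y : dart D) : y \in [:: c; turn c] -> (ncross (smooth y) <= n)%N.
  move=> hy; rewrite -ltnS; apply: leq_trans le_n.
  exact: Skein.ncross_smooth (sane_of gD) hc oc hy.
have -> : bracket val D = A *: bracket_rec val n (smooth c)
    + A^-1 *: bracket_rec val n (smooth (turn c)).
  rewrite /bracket nE; have := sane_of gD; move: hc oc le_n; clear.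
  case: D c => T R e t o g i j c hc oc le_n sn.
  exact: Skein.bracket_rec_skein sn hc oc le_n.
rewrite /bracket /= nE.
by congr (_ *: _ + _ *: _); symmetry; apply: bracket_rec_stable => //;
  do ?[exact: good_smooth | apply: lt; rewrite !inE eqxx ?orbT].
Qed.

Lemma bracket_smooth_opp (D : diagram) (c : dart D) : good D -> crossing c ->
  bracket val (smooth (turn (turn c))) = bracket val (smooth c).
Proof.
move=> gD hc; have := sane_of gD; rewrite /bracket /=; move: hc; clear.
case: D c => T R e t o g i j c hc sn; apply: Skein.same_rec.
exact: Skein.same_opp sn hc.
Qed.

Lemma skein (D : diagram) (c : dart D) : good D -> crossing c ->
  bracket val D = weight c *: bracket val (smooth c)
    + (weight c)^-1 *: bracket val (smooth (turn c)).
Proof.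
move=> gD hc; rewrite /weight; case: ifP => oc; first exact: skein_over.
have [_ _ oE _ _] := gD.
rewrite (@skein_over D (turn c)) ?crossing_turn ?oE ?oc //.
by rewrite bracket_smooth_opp // invrK addrC.
Qed.

Lemma bracket_state (D : diagram) : (forall c : dart D, crossing c = false) ->
  bracket val D = state_value val D.
Proof.
rewrite /bracket => h; case: #|dart D| => //= n.
by case: pickP => // x; rewrite h.
Qed.

End SkeinRelation.

(** A vertex of [X] is not crossed: strands are followed along edges and through the vertices inside
    the disc only. *)
Definition strand (D : diagram) (X : {set dart D}) : rel (dart D) :=
  [rel d e | (e == edge d) || (d \notin X) && (e == turn d)].

(** * Diagrams which agree outside of a disc *)

(* [D1] and [D2] are matched by [phi] outside of a disc which contains plain
   points only.  [X] holds the darts at the vertices of [D2] outside of the disc,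
   in particular at all its crossings and endpoints; [P] the darts whose strands
   and regions are compared.  Only the way in which the strands join the darts of
   [P] through the disc matters, hence the comparison of the relations [strand],
   and of the regions through [h] and [k].  The darts in [N] are exempted: they
   form the additional circle of [null_circle], which bounds the region [r]. *)
Record match_off (D1 D2 : diagram) (phi : dart D2 -> dart D1)
    (X P : {set dart D2}) (N : {set dart D1})
    (h : region D1 -> region D2) (k : region D2 -> region D1) : Prop :=
  MatchOff {
  mo_inj : {in P &, injective phi};
  mo_sub : X \subset P;
  mo_X : {in X, forall x, turn x \in X};
  mo_turn : {in X, forall x, phi (turn x) = turn (phi x)};
  mo_over : {in X, forall x, crossing x -> over (phi x) = over x};
  mo_off2 : forall y, y \notin X -> (turn (turn y) == y) && (turn y != y);
  mo_off1 : forall z, z \notin phi @: X -> (turn (turn z) == z) && (turn z != z);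
  mo_strand : {in P &, forall x y,
    connect (strand (phi @: X)) (phi x) (phi y) = connect (strand X) x y};
  mo_P2 : forall y, exists2 x, x \in P & connect (strand X) x y;
  mo_P1 : forall z, z \notin N ->
    exists2 x, x \in P & connect (strand (phi @: X)) (phi x) z;
  mo_h : {in P, forall x,
    h (reg (phi x)) = reg x /\ h (reg (edge (phi x))) = reg (edge x)};
  mo_k : {in P, forall x,
    k (reg x) = reg (phi x) /\ k (reg (edge x)) = reg (edge (phi x))};
  mo_hio : h (inner D1) = inner D2 /\ h (outer D1) = outer D2;
  mo_kio : k (inner D2) = inner D1 /\ k (outer D2) = outer D1
}.

Record null_circle (D1 D2 : diagram) (phi : dart D2 -> dart D1)
    (X P : {set dart D2}) (N : {set dart D1}) (r : region D1)
    (h : region D1 -> region D2) : Prop := NullCircle {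
  nc_class : exists z, N = [set w | connect (strand (phi @: X)) z w];
  nc_P : {in P, forall x, phi x \notin N};
  nc_h : {in N, forall z, h (reg z) = h (reg (edge z))};
  nc_r : forall z, (reg z == r) (+) (reg (edge z) == r) = (z \in N);
  nc_io : inner D1 != r /\ outer D1 != r;
  nc_rP : {in P, forall x, reg (phi x) != r}
}.

(** [b] tells whether [D1] carries the additional null-homotopic circle. *)
Definition local_equiv (b : bool) (D1 D2 : diagram) : Prop :=
  [/\ good D1, good D2 & exists phi X P N r h k,
    @match_off D1 D2 phi X P N h k /\
    if b then @null_circle D1 D2 phi X P N r h else N = set0].

Section Smoothing.
Variables (D1 D2 : diagram) (phi : dart D2 -> dart D1) (X P : {set dart D2}).
Variables (N : {set dart D1}) (r : region D1).
Variables (h : region D1 -> region D2) (k : region D2 -> region D1).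
Hypothesis (mo : match_off phi X P N h k).
Hypothesis (g2 : good D2).
Variable (c : dart D2).
Hypothesis (hc : crossing c).

Let cX : c \in X.
Proof.
by apply: contraLR hc => /(mo_off2 mo) /andP[/eqP h2 _]; rewrite /crossing h2 eqxx.
Qed.

Let XP x : x \in X -> x \in P. Proof. exact/subsetP/(mo_sub mo). Qed.

Let oX : turn (turn c) \in X. Proof. by rewrite !(mo_X mo). Qed.

Let phi_opp : phi (turn (turn c)) = turn (turn (phi c)).
Proof. by rewrite !(mo_turn mo) ?(mo_X mo). Qed.

Lemma match_crossing : crossing (phi c).
Proof. by rewrite /crossing -phi_opp (inj_in_eq (mo_inj mo)) ?XP. Qed.

Let phi_mem x : x \in X ->
  (phi x \in [:: phi c; turn (turn (phi c))]) = (x \in [:: c; turn (turn c)]).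
Proof. by move=> xX; rewrite !inE -phi_opp !(inj_in_eq (mo_inj mo)) ?XP. Qed.

Let off1 z : z \notin phi @: X -> z \in [:: phi c; turn (turn (phi c))] = false.
Proof.
by apply: contraNF; rewrite !inE -phi_opp => /orP[] /eqP ->; apply: imset_f.
Qed.

Let off2 y : y \notin X -> y \in [:: c; turn (turn c)] = false.
Proof. by apply: contraNF; rewrite !inE => /orP[] /eqP ->. Qed.

(** The smoothing changes [turn] at vertices outside of the disc only, where [strand] does not use
    it. *)
Let strand1 : @strand (smooth (phi c)) (phi @: X) =2 strand (phi @: X).
Proof.
move=> d e; rewrite /strand /=; case dX: (_ \in phi @: X) => //=.
by rewrite off1 ?dX.
Qed.

Let strand2 : @strand (smooth c) X =2 strand X.
Proof.
by move=> d e; rewrite /strand /=; case dX: (_ \in X) => //=; rewrite off2 ?dX.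
Qed.

Let m1 := merge (reg (phi c)) (reg (turn (turn (phi c)))).
Let m2 := merge (reg c) (reg (turn (turn c))).

(** [h] sends the two regions merged in [D1] to the two merged in [D2], so [m2 \o h] takes the same
    value on them. *)
Let m2h u : m2 (h (m1 u)) = m2 (h u).
Proof.
rewrite /m1 /merge; case: eqP => // ->.
have [-> _] := mo_h mo (XP cX); rewrite -phi_opp.
by have [-> _] := mo_h mo (XP oX); rewrite /m2 /merge eqxx; case: eqP.
Qed.

Let m1k u : m1 (k (m2 u)) = m1 (k u).
Proof.
rewrite /m2 /merge; case: eqP => // ->.
have [-> _] := mo_k mo (XP cX); have [-> _] := mo_k mo (XP oX).
by rewrite phi_opp /m1 /merge eqxx; case: eqP.
Qed.

Lemma match_smooth : @match_off (smooth (phi c)) (smooth c) phi X P N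
  (fun u => m2 (h u)) (fun u => m1 (k u)).
Proof.
split; try by case: mo.
- move=> x xX /=; rewrite -/(turn x); case: ifP => _; by rewrite !(mo_X mo).
- move=> x xX /=; rewrite phi_mem //.
  by case: ifP; rewrite !(mo_turn mo) ?(mo_X mo).
- move=> x xX; rewrite /crossing /= => hx; apply: (mo_over mo xX).
  by move: hx; rewrite [_ != _](Skein.st_cross (turn4 g2) _ hc) => /andP[].
- move=> y yX; have /andP[t2 t1] := mo_off2 mo yX.
  have tX : @turn D2 y \notin X.
    by apply: contra yX => tX; have := mo_X mo tX; rewrite (eqP t2).
  by rewrite /= (off2 yX) (off2 tX) t2.
- move=> z zX; have /andP[t2 t1] := mo_off1 mo zX.
  have tX : @turn D1 z \notin phi @: X.
    apply: contra zX => /imsetP[x xX zx].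
    by rewrite -(eqP t2) zx -(mo_turn mo) // imset_f ?(mo_X mo).
  by rewrite /= (off1 zX) (off1 tX) t2.
- by move=> x y xP yP; rewrite (eq_connect strand1) (eq_connect strand2) (mo_strand mo).
- by move=> y; have [x xP xy] := mo_P2 mo y; exists x; rewrite // (eq_connect strand2).
- by move=> z /(mo_P1 mo)[x xP xz]; exists x; rewrite // (eq_connect strand1).
- by move=> x xP; have [h1 h2] := mo_h mo xP; rewrite /= -!/m1 !m2h h1 h2.
- by move=> x xP; have [h1 h2] := mo_k mo xP; rewrite /= -!/m2 !m1k h1 h2.
- by have [h1 h2] := mo_hio mo; rewrite /= -!/m1 !m2h h1 h2.
- by have [h1 h2] := mo_kio mo; rewrite /= -!/m2 !m1k h1 h2.
Qed.

Lemma null_smooth : null_circle phi X P N r h ->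
  @null_circle (smooth (phi c)) (smooth c) phi X P N r (fun u => m2 (h u)).
Proof.
case=> [[z zN] NP hN rE [ri ro] rP].
(* The crossing has its darts in [P], so neither of the merged regions is [r]: the disc bounded by
   the circle is untouched. *)
have mr u : (m1 u == r) = (u == r).
  rewrite /m1 /merge; case: (u =P _) => // ->.
  by rewrite -phi_opp !(negPf (rP _ _)) ?XP.
split=> //.
- by exists z; rewrite zN; apply/setP=> w; rewrite !inE (eq_connect strand1).
- by move=> w /hN hw; rewrite /= -!/m1 !m2h hw.
- by move=> w; rewrite /= -!/m1 !mr rE.
- by rewrite /= -!/m1 !mr.
- by move=> x xP; rewrite /= -!/m1 mr rP.
Qed.

End Smoothing.

Lemma local_equiv_smooth b D1 D2 (c : dart D2) : local_equiv b D1 D2 ->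
  crossing c -> over c -> exists2 c1 : dart D1, crossing c1 &
  [/\ over c1, local_equiv b (smooth c1) (smooth c)
    & local_equiv b (smooth (turn c1)) (smooth (turn c))].
Proof.
case=> g1 g2 [phi [X [P [N [r [h [k [mo nc]]]]]]]] hc oc.
have hc1 := match_crossing mo hc.
have hct : crossing (turn c) by rewrite crossing_turn.
have hct1 := match_crossing mo hct.
have cX : c \in X.
  by apply: contraLR hc => /(mo_off2 mo) /andP[/eqP h2 _]; rewrite /crossing h2 eqxx.
exists (phi c) => //; split; first by rewrite (mo_over mo).
- split; try exact: good_smooth.
  do 7!eexists; split; first exact: (match_smooth mo g2 hc).
  by case: b nc => // nc; apply: (null_smooth mo hc nc).
- rewrite -(mo_turn mo) //; split; try exact: good_smooth.
  do 7!eexists; split; first exact: (match_smooth mo g2 hct).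
  by case: b nc => // nc; apply: (null_smooth mo hct nc).
Qed.

(** * Values of matched states *)

(** Each of the four kinds of circle prescribes three bits of a side, always one without the outer
    boundary circle, so one transport argument serves all four. *)
Definition side_type (D : diagram) (C : {set dart D}) (a b c : bool) : bool :=
  [exists S : {set region D}, [&& bounds C S, (inner D \in S) == a,
     (outer D \in S) == b & has_knotoid S == c]].

Lemma null_homotopicE (D : diagram) (C : {set dart D}) :
  null_homotopic C = side_type C false false false.
Proof. by apply: eq_existsb => S; rewrite !eqbF_neg. Qed.

Lemma enclosingE (D : diagram) (C : {set dart D}) :
  enclosing C = side_type C false false true.
Proof. by apply: eq_existsb => S; rewrite !eqbF_neg eqb_id. Qed.

Lemma inner_essentialE (D : diagram) (C : {set dart D}) :
  inner_essential C = side_type C true false false.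
Proof. by apply: eq_existsb => S; rewrite !eqbF_neg eqb_id. Qed.

Lemma outer_essentialE (D : diagram) (C : {set dart D}) :
  outer_essential C = side_type C true false true.
Proof. by apply: eq_existsb => S; rewrite !eqbF_neg !eqb_id. Qed.

Section Crossingless.
Variable D : diagram.
Hypotheses (gD : good D) (state : forall d : dart D, crossing d = false).

Lemma turnK : involutive (@turn D).
Proof. by move=> d; apply/eqP; move/negbFE: (state d). Qed.

Lemma bounds_edge (C : {set dart D}) (S : {set region D}) : bounds C S =
  [forall d, (reg d \in S) (+) (reg (edge d) \in S) == (d \in C)].
Proof.
apply: eq_forallb => d; have [_ _ _ [fE _] _] := gD.
by rewrite -(fE (turn d)) turnK.
Qed.

(** Without crossings, passing along an edge or through a vertex keeps the two sides of a strand,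
    possibly exchanged. So [bounds] need only be tested at one dart of each strand. *)
Lemma sides_joined (S : {set region D}) (x y : dart D) :
  connect (@joined D) x y ->
  (reg x \in S) (+) (reg (edge x) \in S) = (reg y \in S) (+) (reg (edge y) \in S).
Proof.
have [eK _ _ [fE _] _] := gD.
case/connectP=> s sP ->; elim: s x sP => //= z s IH x /andP[xz sP].
rewrite -IH //; case/orP: xz => /eqP ->; first by rewrite eK addbC.
by rewrite fE -(fE (turn x)) turnK addbC.
Qed.

Lemma joined_sym : connect_sym (@joined D).
Proof.
have [eK _ _ _ _] := gD.
apply: sym_connect_sym => x y; rewrite /joined /=; congr (_ || _); apply/eqP/eqP.
- by move=> ->; rewrite eK.
- by move=> ->; rewrite eK.
- by move=> ->; rewrite turnK.
- by move=> ->; rewrite turnK.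
Qed.

Lemma component_eq (x y : dart D) :
  (component x == component y) = connect (@joined D) x y.
Proof.
apply/eqP/idP => [/setP/(_ y)|xy]; first by rewrite !inE connect0.
by apply/setP=> z; rewrite !inE (same_connect joined_sym xy).
Qed.

Lemma strand_joined X (x y : dart D) :
  connect (strand X) x y -> connect (@joined D) x y.
Proof.
apply: connect_sub => u v; rewrite /strand /= => /orP[uv|/andP[_ uv]];
  by apply: connect1; rewrite /joined /= uv ?orbT.
Qed.

End Crossingless.

Section StateMatch.
Variables (D1 D2 : diagram) (phi : dart D2 -> dart D1) (X P : {set dart D2}).
Variables (N : {set dart D1}) (r : region D1).
Variables (h : region D1 -> region D2) (k : region D2 -> region D1).
Hypothesis (mo : match_off phi X P N h k).
Hypotheses (g1 : good D1) (g2 : good D2).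
Hypotheses (s1 : forall d : dart D1, crossing d = false).
Hypotheses (s2 : forall d : dart D2, crossing d = false).

Let XP x : x \in X -> x \in P. Proof. exact/subsetP/(mo_sub mo). Qed.

Local Notation J1 := (connect (@joined D1)).
Local Notation J2 := (connect (@joined D2)).
Local Notation C1 := (connect (strand (phi @: X))).
Local Notation C2 := (connect (strand X)).

Let C1step u v z : C1 u v -> strand (phi @: X) v z -> C1 u z.
Proof. by move=> uv vz; apply: connect_trans uv (connect1 vz). Qed.

Let C2step u v z : C2 u v -> strand X v z -> C2 u z.
Proof. by move=> uv vz; apply: connect_trans uv (connect1 vz). Qed.

(** The path is followed step by step together with a dart [m] of [P] from which the current dart is
    reached by steps of [strand]; [m] is renewed when a vertex outside of the disc is crossed. *)
Let J1to2 x z : x \in P -> J1 (phi x) z ->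
  exists m, [/\ m \in P, J2 x m & C1 (phi m) z].
Proof.
move=> xP /connectP[s sP ->]; elim/last_ind: s sP => [_|s u IH].
  by exists x; split; rewrite ?connect0.
rewrite rcons_path last_rcons => /andP[/IH[m [mP xm mz]]].
set z' := last _ _ in mz *; case/orP=> /eqP ->.
  by exists m; split=> //; apply: C1step mz _; rewrite /strand /= eqxx.
case zX: (z' \in phi @: X); last first.
  by exists m; split=> //; apply: C1step mz _; rewrite /strand /= zX eqxx orbT.
case/imsetP: zX => y yX zE; rewrite zE in mz *.
have yP := XP yX; exists (turn y); split; first exact/XP/(mo_X mo).
  apply: (@connect_trans _ _ y); last first.
    by apply: connect1; rewrite /joined /= eqxx orbT.
  apply: (connect_trans xm); apply: (@strand_joined _ X).
  by rewrite -(mo_strand mo).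
by rewrite (mo_turn mo) // connect0.
Qed.

Let J2to1 x y : x \in P -> J2 x y ->
  exists m, [/\ m \in P, J1 (phi x) (phi m) & C2 m y].
Proof.
move=> xP /connectP[s sP ->]; elim/last_ind: s sP => [_|s u IH].
  by exists x; split; rewrite ?connect0.
rewrite rcons_path last_rcons => /andP[/IH[m [mP xm mz]]].
set z := last _ _ in mz *; case/orP=> /eqP ->.
  by exists m; split=> //; apply: C2step mz _; rewrite /strand /= eqxx.
case zX: (z \in X); last first.
  by exists m; split=> //; apply: C2step mz _; rewrite /strand /= zX eqxx orbT.
have zP := XP zX; exists (turn z); split; [exact/XP/(mo_X mo) | | exact: connect0].
rewrite (mo_turn mo) //.
apply: (@connect_trans _ _ (phi z)); last first.
  by apply: connect1; rewrite /joined /= eqxx orbT.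
apply: (connect_trans xm); apply: (@strand_joined _ (phi @: X)).
by rewrite (mo_strand mo).
Qed.

Let JE x y : x \in P -> y \in P -> J1 (phi x) (phi y) = J2 x y.
Proof.
move=> xP yP; apply/idP/idP.
  move=> /(J1to2 xP)[m [mP xm my]]; apply: (connect_trans xm).
  apply: (@strand_joined _ X).
  by rewrite -(mo_strand mo).
move=> /(J2to1 xP)[m [mP xm my]].
apply: (connect_trans xm); apply: (@strand_joined _ (phi @: X)).
by rewrite (mo_strand mo).
Qed.

Let endX (y : dart D2) : endpoint y -> y \in X.
Proof.
by apply: contraLR => /(mo_off2 mo)/andP[_]; rewrite /endpoint.
Qed.

Let endX1 (z : dart D1) : endpoint z -> exists2 x, x \in X & z = phi x.
Proof.
move=> ez; apply/imsetP; apply: contraLR ez.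
by move=> /(mo_off1 mo)/andP[_]; rewrite /endpoint.
Qed.

Let endE x : x \in X -> endpoint (phi x) = endpoint x.
Proof.
move=> xX; rewrite /endpoint -(mo_turn mo) //.
by rewrite (inj_in_eq (mo_inj mo)) ?XP ?(mo_X mo).
Qed.

Let circleE x : x \in P ->
  [forall e in component (phi x), ~~ endpoint e]
  = [forall e in component x, ~~ endpoint e].
Proof.
move=> xP; apply/forall_inP/forall_inP => hx y.
  rewrite inE => xy; apply/negP=> ey; have yX := endX ey.
  by have := hx (phi y); rewrite inE JE ?(XP yX) // endE // ey => /(_ xy).
rewrite inE => xy; apply/negP=> ey; have [z zX yE] := endX1 ey.
move: xy ey; rewrite yE JE ?(XP zX) // endE // => xz ez.
by have := hx z; rewrite inE xz ez => /(_ isT).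
Qed.

Hypothesis extra : N != set0 -> null_circle phi X P N r h.

Let sideE x a b c : x \in P ->
  side_type (component (phi x)) a b c = side_type (component x) a b c.
Proof.
move=> xP; apply/existsP/existsP => -[S /and4P[]]; rewrite bounds_edge //.
  move=> /forallP bS /eqP iS /eqP oS /eqP kS.
  (* The side is pulled back along [k], and along [h] in the converse; both maps respect the regions
     next to [P]. *)
  exists [set u | k u \in S]; have [-> ->] : (inner D2 \in [set u | k u \in S] = a)
    /\ (outer D2 \in [set u | k u \in S] = b).
    by rewrite !inE; have [-> ->] := mo_kio mo.
  rewrite !eqxx bounds_edge //= -kS; apply/andP; split; last first.
    apply/eqP; apply/existsP/existsP => -[y /andP[ey yS]].
      exists (phi y); rewrite endE ?endX // ey /=.
      by move: yS; rewrite inE; have [-> _] := mo_k mo (XP (endX ey)).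
    have [z zX yE] := endX1 ey; exists z; rewrite -endE // -yE ey /=.
    by rewrite inE; have [-> _] := mo_k mo (XP zX); rewrite -yE.
  apply/forallP=> y; have [m mP my] := mo_P2 mo y.
  rewrite -(sides_joined g2 s2 _ (strand_joined my)) !inE.
  have [-> ->] := mo_k mo mP; rewrite (eqP (bS (phi m))) inE JE //.
  by rewrite (same_connect_r (joined_sym g2 s2) (strand_joined my)).
move=> /forallP bS /eqP iS /eqP oS /eqP kS.
exists [set u | h u \in S]; have [-> ->] : (inner D1 \in [set u | h u \in S] = a)
  /\ (outer D1 \in [set u | h u \in S] = b).
  by rewrite !inE; have [-> ->] := mo_hio mo.
rewrite !eqxx bounds_edge //= -kS; apply/andP; split; last first.
  apply/eqP; apply/existsP/existsP => -[y /andP[ey yS]].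
    have [z zX yE] := endX1 ey; exists z; rewrite -endE // -yE ey /=.
    by move: yS; rewrite yE inE; have [-> _] := mo_h mo (XP zX).
  exists (phi y); rewrite endE ?endX // ey /=.
  by rewrite inE; have [-> _] := mo_h mo (XP (endX ey)).
(* On the additional circle [h] identifies both sides, so the pulled back set does not separate
   them; accordingly this circle is disjoint from the component of [phi x]. *)
apply/forallP=> z; have [zN|zN] := boolP (z \in N).
  have /extra[[z0 NE] NP hN _ _ _] : N != set0 by apply/set0Pn; exists z.
  rewrite !inE hN // addbb; apply/eqP/esym/negP => /(J1to2 xP)[m [mP _ mz]].
  have := NP m mP; rewrite NE inE; move: zN; rewrite NE inE => zN.
  suff -> : connect (strand (phi @: X)) z0 (phi m) by [].
  apply: connect_trans zN _; rewrite sym_connect_sym //; have [eK _ _ _ _] := g1.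
  move=> u v; rewrite /strand /=; congr (_ || _).
    by apply/eqP/eqP => ->; rewrite eK.
  have tX w : turn w \in phi @: X -> w \in phi @: X.
    by case/imsetP=> w' wX /(congr1 (@turn D1)); rewrite turnK // => ->;
      rewrite -(mo_turn mo) // imset_f ?(mo_X mo).
  by apply/andP/andP=> -[uX /eqP ->]; rewrite turnK // eqxx;
    split=> //; apply: contra uX; apply: tX.
have [m mP mz] := mo_P1 mo zN.
rewrite -(sides_joined g1 s1 _ (strand_joined mz)) !inE.
have [-> ->] := mo_h mo mP; rewrite (eqP (bS m)) inE -JE //.
by rewrite (same_connect_r (joined_sym g1 s1) (strand_joined mz)).
Qed.

Let lift (C : {set dart D2}) : {set dart D1} :=
  [set z | [exists x in P, (x \in C) && J1 (phi x) z]].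

Let lift_component x : x \in P -> lift (component x) = component (phi x).
Proof.
move=> xP; apply/setP=> z; rewrite !inE; apply/exists_inP/idP.
  case=> y yP; rewrite inE => /andP[xy yz]; apply: connect_trans yz.
  by rewrite JE.
by move=> xz; exists x; rewrite // inE connect0.
Qed.

Let circles2P C : C \in circles D2 -> exists2 x, x \in P & C = component x.
Proof.
case/imsetP=> y _ ->; have [x xP xy] := mo_P2 mo y; exists x => //.
by apply/esym/eqP; rewrite component_eq //; apply: strand_joined xy.
Qed.

Let mem_circles x : x \in P ->
  (component (phi x) \in circles D1) = (component x \in circles D2).
Proof.
have memE (D : diagram) (d : dart D) :
    (component d \in circles D) = [forall e in component d, ~~ endpoint e].
  apply/imsetP/idP => [[e]|hd]; last by exists d; rewrite // inE.
  by rewrite inE => he ->.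
by move=> xP; rewrite !memE circleE.
Qed.

Let componentN z : z \in N -> component z = N.
Proof.
move=> zN; have /extra[[z0 NE] NP _ _ _ _] : N != set0 by apply/set0Pn; exists z.
have z0z : C1 z0 z by move: zN; rewrite NE inE.
apply/eqP; rewrite eqEsubset; apply/andP; split; apply/subsetP=> w.
  rewrite inE => /connectP[s sP ->]; elim: s z zN {z0z} sP => //= u s IH z zN.
  case/andP=> zu; apply: IH; move: zN; rewrite NE !inE => zN.
  have zX : z \notin phi @: X.
    by apply/imsetP=> -[x xX zx]; have := NP x (XP xX); rewrite -zx NE inE zN.
  by apply: C1step zN _; rewrite /strand /= zX.
rewrite NE inE => z0w; have := strand_joined z0z; rewrite joined_sym // inE.
by move=> zz0; apply: connect_trans zz0 (strand_joined z0w).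
Qed.

Let N_circle : N != set0 -> N \in circles D1.
Proof.
move=> nN; have [_ NP _ _ _ _] := extra nN; have [z zN] := set0Pn _ nN.
apply/imsetP; exists z; last by rewrite componentN.
rewrite inE componentN //; apply/forall_inP=> e eN; apply/negP=> /endX1[x xX ex].
by move: eN; rewrite ex; apply/negP/NP/XP.
Qed.

Let count_circles (q1 : pred {set dart D1}) (q2 : pred {set dart D2}) :
  {in P, forall x, q1 (component (phi x)) = q2 (component x)} ->
  #|[set C in circles D1 | q1 C]|
  = (((N != set0) && q1 N) + #|[set C in circles D2 | q2 C]|)%N.
Proof.
move=> q12; rewrite (cardsD1 N) inE; congr (_ + _)%N.
  case: (eqVneq N set0) => [N0|nN] /=; last by rewrite N_circle.
  apply/eqP; rewrite eqb0 N0; apply/negP=> /andP[/imsetP[d _ /setP/(_ d)]].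
  by rewrite !inE connect0.
(* [lift] matches the circles of [D2] with the circles of [D1] other than [N]. *)
rewrite -(card_in_imset (f := lift)); last first.
  move=> C C'; rewrite !inE => /andP[/circles2P[x xP ->] _].
  case/andP=> /circles2P[y yP ->] _; rewrite !lift_component // => /eqP.
  by rewrite component_eq // JE // => xy; apply/eqP; rewrite component_eq.
apply: eq_card => C; rewrite !inE; apply/and3P/imsetP => [[CN Cc qC]|].
  have /imsetP[z hz CE] := Cc; rewrite {}CE {C} in CN Cc qC *.
  have zN : z \notin N by apply: contraNN CN => /componentN ->.
  have [x xP xz] := mo_P1 mo zN.
  have xzE : component z = component (phi x).
    by apply/esym/eqP; rewrite component_eq //; apply: strand_joined xz.
  exists (component x); last by rewrite lift_component.
  by rewrite inE -mem_circles // -q12 // -xzE Cc.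
case=> C'; rewrite inE => /andP[C'c qC'] ->; have [x xP CE] := circles2P C'c.
rewrite CE lift_component // mem_circles // q12 // -CE; split=> //.
apply: contraTneq C'c => NE.
have xN : phi x \in N by rewrite -NE inE connect0.
have /extra[_ NP _ _ _ _] : N != set0 by apply/set0Pn; exists (phi x).
by have := NP x xP; rewrite xN.
Qed.

(* The surface being connected, a side of the circle [N] is [r] or its
   complement, so [N] is null-homotopic and nothing else. *)
Let N_side a c : N != set0 -> side_type N a false c = ~~ a && ~~ c.
Proof.
move=> nN; have [[z0 NE] NP _ rE [ri ro] rP] := extra nN.
have endr d : endpoint d -> (reg d == r) = false.
  by case/endX1=> x xX ->; apply/negbTE/rP/XP.
apply/existsP/idP => [[S /and4P[]]|/andP[/negPf -> /negPf ->]]; last first.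
  exists [set r]; rewrite !inE !eqbF_neg ri ro bounds_edge //.
  apply/and3P; split=> //; first by apply/forallP=> d; rewrite !inE rE.
  by apply/existsPn=> d; rewrite inE; apply/nandP; case: (boolP (endpoint d)) =>
    [/endr ->|]; [right | left].
rewrite bounds_edge // eqbF_neg => /forallP bS /eqP <- oS /eqP <-.
have [_ _ _ [fE [/codomP[di iE] /codomP[do_ oE]]] con] := g1.
have fS : forall d e : dart D1,
    (reg d \in S) (+) (reg d == r) = (reg e \in S) (+) (reg e == r).
  have fe (d : dart D1) : (reg (edge d) \in S) (+) (reg (edge d) == r)
      = (reg d \in S) (+) (reg d == r).
    have := bS d; rewrite -rE => /eqP.
    by do 4!case: (_ \in _) || case: (_ == _).
  apply: con => // [d|d e ->] //.
  by rewrite -[RHS]fe -(fE (turn d)) turnK.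
have S0 d : (reg d \in S) = (reg d == r).
  have := fS d do_; rewrite -oE (negPf oS) (negPf ro).
  by case: (_ \in _) (_ == _) => -[].
rewrite iE S0 -iE ri /=; apply/existsPn=> d; rewrite S0.
by apply/nandP; case: (boolP (endpoint d)) => [/endr ->|]; [right | left].
Qed.

Lemma state_value_match (B : lmodType Laurent) (val : nat -> nat -> nat -> B) :
  state_value val D1 = d_loop ^+ (N != set0) *: state_value val D2.
Proof.
(* By [N_side] the additional circle is counted once, among the null-homotopic ones, whence the
   factor [d_loop]. *)
have cnt a c : #|[set C in circles D1 | side_type C a false c]|
    = (((N != set0) && ~~ a && ~~ c)
       + #|[set C in circles D2 | side_type C a false c]|)%N.
  rewrite (count_circles (q2 := fun C => side_type C a false c)); last first.
    by move=> x xP; apply: sideE.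
  by case: (boolP (N != set0)) => // nN; rewrite N_side.
have cntE (D : diagram) (q : pred {set dart D}) a c :
    q =1 (fun C => side_type C a false c) ->
    #|[set C in circles D | q C]| = #|[set C in circles D | side_type C a false c]|.
  by move=> qE; apply: eq_card => C; rewrite !inE qE.
rewrite /state_value !(cntE _ _ _ _ (@null_homotopicE _)).
rewrite !(cntE _ _ _ _ (@enclosingE _)) !(cntE _ _ _ _ (@inner_essentialE _)).
rewrite !(cntE _ _ _ _ (@outer_essentialE _)) !cnt /= !andbT !andbF !add0n.
by rewrite scalerA exprD.
Qed.

End StateMatch.

Lemma local_equiv_bracket (B : lmodType Laurent) (val : nat -> nat -> nat -> B)
    b (D1 D2 : diagram) :
  local_equiv b D1 D2 -> bracket val D1 = d_loop ^+ b *: bracket val D2.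
Proof.
have [n] := ubnP (Skein.ncross (@over D2) (@turn D2)).
elim: n D1 D2 => // n IH D1 D2 le_n E.
have [g1 g2 [phi [X [P [N [r [h [k [mo nc]]]]]]]]] := E.
case: (pickP (fun c : dart D2 => crossing c && over c)) => [c /andP[hc oc]|none].
  have [c1 hc1 [oc1 E1 E2]] := local_equiv_smooth E hc oc.
  have lt y : y \in [:: c; turn c] ->
      (Skein.ncross (@over D2) (@turn (smooth y)) < n)%N.
    move=> hy; rewrite -ltnS; apply: leq_trans le_n; rewrite ltnS.
    exact: Skein.ncross_smooth (sane_of g2) hc oc hy.
  rewrite (skein_over val g1 hc1 oc1) (skein_over val g2 hc oc).
  rewrite (IH _ _ _ E1) ?(IH _ _ _ E2);
    do ?[by apply: lt; rewrite !inE eqxx ?orbT].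
  by rewrite scalerDr !scalerA ![d_loop ^+ b * _]mulrC.
have [_ _ oE2 _ _] := g2.
have s2 (c : dart D2) : crossing c = false.
  apply/negbTE/negP=> hc; have := none c; rewrite hc /= => oc.
  by have := none (turn c); rewrite crossing_turn // hc oE2 // oc.
have s1 (c : dart D1) : crossing c = false.
  apply/negbTE/negP=> hc; have : c \in phi @: X.
    apply: contraLR hc => /(mo_off1 mo) /andP[/eqP h2 _].
    by rewrite /crossing h2 eqxx.
  case/imsetP=> x xX cE; have XP y : y \in X -> y \in P by apply/subsetP/(mo_sub mo).
  have := s2 x; rewrite /crossing -(inj_in_eq (mo_inj mo)) ?XP ?(mo_X mo) //.
  by rewrite !(mo_turn mo) ?(mo_X mo) // -cE [_ != _]hc.
rewrite !bracket_state //.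
rewrite (state_value_match mo g1 g2 s1 s2 (r := r)).
  congr (_ ^+ (nat_of_bool _) *: _); case: b nc {E IH} => [nc|->]; last by rewrite eqxx.
  by have [[z ->] _ _ _ _ _] := nc; apply/set0Pn; exists z; rewrite inE connect0.
by case: b nc {E IH} => // ->; rewrite eqxx.
Qed.

(** * Isomorphism and subdivision *)

Lemma connect_img (T T' : finType) (e : rel T) (e' : rel T') (f : T -> T') :
  (forall a b, e a b -> connect e' (f a) (f b)) ->
  forall x y, connect e x y -> connect e' (f x) (f y).
Proof.
move=> he x y /connectP[s sP ->]; elim: s x sP => //= z s IH x /andP[xz sP].
exact: connect_trans (he _ _ xz) (IH _ sP).
Qed.

Lemma factor_through (T R1 R2 : finType) (f : T -> R1) (g : T -> R2) (r0 : R2) :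
  (forall x y, f x = f y -> g x = g y) -> exists h, forall x, h (f x) = g x.
Proof.
move=> fg; exists (fun u => if [pick x | f x == u] is Some x then g x else r0) => x.
by case: pickP => [y /eqP/fg //|/(_ x)]; rewrite eqxx.
Qed.

Lemma isomorphic_equiv (K K' : odiagram) : annular K -> annular K' ->
  isomorphic K K' -> local_equiv false K' K.
Proof.
move=> aK aK' [phi phi_bij [[eE tE oE _] gE iE oE']].
have [gK gK'] := (annular_good aK, annular_good aK').
split=> //; have [psi phiK psiK] := phi_bij.
have [h hE] : exists h, forall x, h (reg (phi x)) = reg x.
  by apply: factor_through (inner K) _ => x y /eqP; rewrite gE => /eqP.
have [k kE] : exists k, forall x, k (reg x) = reg (phi x).
  by apply: factor_through (inner K') _ => x y /eqP; rewrite -gE => /eqP.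
have [_ _ _ [_ [/codomP[di diE] /codomP[do_ doE]]] _] := gK.
have [_ _ _ [_ [/codomP[di' diE'] /codomP[do' doE']]] _] := gK'.
(* An isomorphism is a match with an empty disc. *)
exists phi, setT, setT, set0, (inner K'), h, k; split=> //; split=> //.
- by move=> x y _ _; apply: bij_inj.
- by move=> x _ hx; rewrite oE.
- by move=> y; rewrite inE.
- by move=> z; rewrite -[z]psiK imset_f ?inE.
- move=> x y _ _; apply/idP/idP.
    rewrite -{2}[x]phiK -{2}[y]phiK; apply: connect_img => a b.
    rewrite /strand /= -[a]psiK imset_f ?inE // orbF => /eqP ->.
    by rewrite -eE !phiK; apply: connect1; rewrite /strand /= eqxx.
  apply: connect_img => a b; rewrite /strand /= inE /= orbF => /eqP ->.
  by apply: connect1; rewrite /strand /= eE eqxx.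
- by move=> y; exists y; rewrite ?inE ?connect0.
- by move=> z _; exists (psi z); rewrite ?inE ?psiK ?connect0.
- by move=> x _; rewrite -eE !hE.
- by move=> x _; rewrite -eE !kE.
- have := iE (psi di'); have := oE' (psi do').
  rewrite !psiK -diE' -doE' !eqxx => /esym/eqP e2 /esym/eqP e1.
  by rewrite diE' doE' -[di']psiK -[do']psiK !hE e1 e2.
- have := iE di; have := oE' do_; rewrite -diE -doE !eqxx => /eqP e2 /eqP e1.
  by rewrite diE doE !kE e1 e2.
Qed.

Lemma subdivide_equiv (K : odiagram) (a : dart K) :
  annular K -> annular (subdivide a) -> local_equiv false (subdivide a) K.
Proof.
move=> aK aK'; have gK := annular_good aK; split=> //; first exact: annular_good.
have [eK _ _ _ _] := gK; have ne : edge a != a by case: aK => -[].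
pose phi (d : dart K) : dart (subdivide a) := inl d.
(* The disc contains the new plain point alone. *)
exists phi, setT, setT, set0, (inner K), id, id; split=> //.
have edge_a : @edge (subdivide a) (inl a) = inr false by rewrite /= eqxx.
have edge_ea : @edge (subdivide a) (inl (edge a)) = inr true.
  by rewrite /= (negPf ne) eqxx.
have step (X : {set _}) x y : @edge (subdivide a) x = y ->
    connect (@strand (subdivide a) X) x y.
  by move=> <-; apply: connect1; rewrite /strand /= eqxx.
have stept b : connect (@strand (subdivide a) (phi @: setT)) (inr b) (inr (~~ b)).
  apply/connect1/orP; right; rewrite eqxx andbT.
  by apply/imsetP=> -[].
split=> //.
- by move=> x y _ _ [].
- by move=> y; rewrite inE.
- case=> [z|b] /=; first by rewrite imset_f ?inE.
  by move=> _; case: b.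
- move=> x y _ _; apply/idP/idP.
    (* [psi] contracts the two new darts to the ends which they face. *)
    pose psi (d : dart (subdivide a)) := match d with
      inl d => d | inr b => if b then edge a else a end.
    rewrite -[x]/(psi (inl x)) -[y]/(psi (inl y)).
    apply: (@connect_img _ _ _ _ psi) => u v /orP[/eqP ->|/andP[]].
      case: u => [u|b] /=; last exact: connect0.
      case: (eqVneq u a) => [->|_] /=; first exact: connect0.
      case: (eqVneq u (edge a)) => [->|_] /=; first exact: connect0.
      by apply: connect1; rewrite /strand /= eqxx.
    case: u => [u|b]; first by rewrite imset_f ?inE.
    by move=> _ /eqP ->; apply: connect1; case: b; rewrite /strand /= ?eK eqxx.
  apply: connect_img => u v; rewrite /strand /= inE /= orbF => /eqP ->.
  case: (eqVneq u a) => [->|na].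
    exact: connect_trans (step _ _ _ edge_a)
      (connect_trans (stept false) (step _ (inr true) _ erefl)).
  case: (eqVneq u (edge a)) => [->|nea]; last first.
    by apply: step; rewrite /= (negPf na) (negPf nea).
  rewrite eK; exact: connect_trans (step _ _ _ edge_ea)
    (connect_trans (stept true) (step _ (inr false) _ erefl)).
- by move=> y; exists y; rewrite ?inE ?connect0.
- case=> [d|b] _; first by exists d; rewrite ?inE ?connect0.
  by exists (if b then edge a else a); case: b; rewrite ?inE //; apply: step.
- move=> x _ /=; split=> //; case: (eqVneq x a) => [->|_] //=.
  by case: (eqVneq x (edge a)) => [->|_] //=; rewrite eK.
- move=> x _ /=; split=> //; case: (eqVneq x a) => [->|_] //=.
  by case: (eqVneq x (edge a)) => [->|_] //=; rewrite eK.
Qed.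

Lemma writhe_isomorphic (K K' : odiagram) : isomorphic K K' -> writhe K = writhe K'.
Proof.
case=> phi [psi phiK psiK] [[_ tE oE fE] _ _ _].
rewrite /writhe [RHS](reindex phi); last by exists psi => x _; rewrite ?phiK ?psiK.
apply: eq_big => [c|c _]; last by rewrite -tE fE.
rewrite fE; have -> : crossing (phi c) = crossing c.
  by rewrite /crossing -!tE (can_eq phiK).
by case hc: (crossing c); rewrite //= oE.
Qed.

Lemma writhe_subdivide (K : odiagram) (a : dart K) :
  writhe (subdivide a) = writhe K.
Proof.
rewrite /writhe big_sumType /= [X in _ + X]big1 ?addr0 //.
by move=> b; rewrite /crossing /= negbK eqxx.
Qed.

(** * Local pictures by computation on indices *)

Local Open Scope nat_scope.

(* The darts at the [m] vertices of a move are numbered by [k < n = 4m], [4i + j]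
   being the [j]-th rotation of a fixed dart of the [i]-th vertex; [I]
   holds the numbers of the darts of the edges inside the disc and [eps] exchanges
   the ends of these edges.  A picture in the disc is given by the rotation [tau]
   and by a list [G] of pairs of labels of regions to be merged, the label [0]
   being that of the empty region of the move. *)
Section Indices.
Variables (n : nat) (I : seq nat) (eps : nat -> nat).
Implicit Types (tau : nat -> nat) (G : seq (nat * nat)).

(** A vertex is crossed from [k] to [tau k], then the edge there is followed if it lies inside the
    disc. The fuel [m] bounds the number of vertices crossed, which stops the walk on a circle. *)
Fixpoint walk tau (m k : nat) : seq nat :=
  k :: if m is m'.+1 then
         if tau k \in I then tau k :: walk tau m' (eps (tau k)) else [:: tau k]
       else [::].

Definition chain tau k :=
  walk tau n k ++ if k \in I then walk tau n (eps k) else [::].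

(* the least end of the strand through [k] on the boundary of the disc, or [n] if
   that strand is a circle inside the disc *)
Definition anchor tau k :=
  find (fun j => (j \notin I) && (j \in chain tau k)) (iota 0 n).

(* tabulated, so that iterated smoothings stay cheap to evaluate *)
Definition smooth_turn tau (j : nat) : nat -> nat :=
  nth 0 [seq if k \in [:: j; tau (tau j)] then tau (tau (tau k)) else tau k
        | k <- iota 0 n].

(** A representative of [a] for the equivalence relation generated by the pairs in [G]. *)
Definition part G : nat -> nat :=
  foldr (fun ab f a => merge (f ab.1) (f ab.2) (f a)) id G.

(* The empty region may disappear or be absorbed; a region [c] which meets the
   boundary of the disc then stands for it. *)
Definition refill (c a : nat) := if a == 0 then c else a.

(** That [anchor] is constant along the strands of the disc is tested here, at every dart, rather
    than derived from [walk]. When [b] holds, all darts of [I] must lie on one circle. *)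
Definition pairing_ok b tau := all (fun k =>
  [&& tau k < n, tau (tau k) == k, tau k != k, anchor tau (tau k) == anchor tau k,
      (k \in I) ==> (anchor tau (eps k) == anchor tau k),
      (anchor tau k < n) ==> (anchor tau (anchor tau k) == anchor tau k)
    & if b && (k \in I) then (0 \in chain tau k) && (tau k \in I)
      else anchor tau k < n])
  (iota 0 n).

Definition refines c G1 G2 := all (fun ab =>
  part G2 (refill c ab.1) == part G2 (refill c ab.2)) G1.

(** The circle must bound the empty region: label [0] stays unmerged and lies on exactly one side of
    each edge in [I]. Filling it with [c] makes the two sides agree in the other diagram. *)
Definition circle_ok (lab : nat -> nat) c G1 G2 :=
  [&& 0 \in I, all (fun ab => (ab.1 != 0) && (ab.2 != 0)) G1
    & all (fun k => ((lab k == 0) (+) (lab (eps k) == 0)) &&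
        (part G2 (refill c (lab k)) == part G2 (refill c (lab (eps k))))) I].

Definition check b lab tau1 G1 tau2 G2 :=
  [&& pairing_ok b tau1, pairing_ok false tau2,
      all (fun k => (k \in I) || (anchor tau1 k == anchor tau2 k)) (iota 0 n),
      has (fun c => refines c G1 G2 && (b ==> circle_ok lab c G1 G2)) (iota 1 n)
    & has (fun c => refines c G2 G1) (iota 1 n)].

End Indices.

(** * Index pictures placed in diagrams *)

Section Frame.
Variables (K : diagram) (s : seq (dart K)) (I : seq nat) (eps : nat -> nat).
Variables (x0 : dart K) (rs : seq (region K)) (r0 : region K).

Notation v := (nth x0 s).
Notation n := (size s).

(** Labels out of range denote [r0]; the moves take it to be the inner region, so that every
    positive label avoids the empty region. *)
Definition label (a : nat) : region K := nth r0 rs a.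

Definition internal : {set dart K} := [set d | d \in map v I].

Record frame : Prop := Frame {
  fr_good : good K;
  fr_uniq : uniq s;
  fr_turn : forall d, d \notin s -> turn d \notin s;
  fr_int : {in I, forall k, [/\ k < n, eps k \in I & edge (v k) = v (eps k)]};
  fr_reg : forall d, d \notin internal -> reg d != label 0;
  fr_io : (inner K != label 0) && (outer K != label 0);
  fr_label : forall a, 0 < a -> label a != label 0
}.

(* The regions of [D] are those of [K] with the pairs in [G] identified: [pl_univ] is
   the universal property of this quotient, which does not name its elements. *)
Record placed (D : diagram) (phi : dart K -> dart D) (tau lab : nat -> nat)
    (m : region K -> region D) (G : seq (nat * nat)) : Prop := Placed {
  pl_inj : injective phi;
  pl_surj : forall z, exists x, z = phi x;
  pl_edge : forall x, edge (phi x) = phi (edge x);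
  pl_turn : forall x, x \notin s -> turn (phi x) = phi (turn x);
  pl_over : forall x, x \notin s -> over (phi x) = over x;
  pl_tau : forall k, k < n -> (tau k < n) && (turn (phi (v k)) == phi (v (tau k)));
  pl_reg : forall x, x \notin internal -> reg (phi x) = m (reg x);
  pl_lab : forall k, k < n -> reg (phi (v k)) = m (label (lab k));
  pl_io : inner D = m (inner K) /\ outer D = m (outer K);
  pl_id : {in G, forall ab, m (label ab.1) = m (label ab.2)};
  pl_univ : forall (U : finType) (h : region K -> U),
    {in G, forall ab, h (label ab.1) = h (label ab.2)} ->
    exists h' : region D -> U, forall u, h' (m u) = h u
}.

Hypothesis fr : frame.

Lemma placed_smooth D phi tau lab m G j : @placed D phi tau lab m G ->
  j < n ->
  @placed (smooth (phi (v j))) phi (smooth_turn n tau j) lab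
    (fun u => merge (m (label (lab j))) (m (label (lab (tau (tau j))))) (m u))
    ((lab j, lab (tau (tau j))) :: G).
Proof.
move=> pl jn; have [t1 /eqP e1] := andP (pl_tau pl jn).
have [t2 /eqP e2] := andP (pl_tau pl t1).
have oppE : turn (turn (phi (v j))) = phi (v (tau (tau j))) by rewrite e1 e2.
have regE : reg (phi (v j)) = m (label (lab j)) by apply: (pl_lab pl).
have regE' : reg (phi (v (tau (tau j)))) = m (label (lab (tau (tau j)))).
  exact: (pl_lab pl).
have memE k : k < n ->
    (phi (v k) \in [:: phi (v j); turn (turn (phi (v j)))])
    = (k \in [:: j; tau (tau j)]).
  by move=> kn; rewrite oppE !inE !(inj_eq (pl_inj pl)) !nth_uniq ?(fr_uniq fr).
split; try by case: pl.
- move=> x xs /=; rewrite oppE !inE !(inj_eq (pl_inj pl)).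
  have xE k : k < n -> (x == v k) = false.
    by move=> kn; apply: contraNF xs => /eqP ->; apply: mem_nth.
  by rewrite !xE //= (pl_turn pl).
- move=> k kn; rewrite /= memE // /smooth_turn (nth_map 0) ?size_iota // nth_iota //.
  have [t3 /eqP e3] := andP (pl_tau pl kn).
  case: ifP => _; last by rewrite t3 e3 eqxx.
  have [t4 /eqP e4] := andP (pl_tau pl t3).
  have [t5 /eqP e5] := andP (pl_tau pl t4).
  by rewrite t5 e3 e4 e5 eqxx.
- by move=> x xP /=; rewrite oppE regE regE' (pl_reg pl).
- by move=> k kn /=; rewrite oppE regE regE' (pl_lab pl).
- by rewrite /= oppE regE regE'; have [-> ->] := pl_io pl.
- move=> ab; rewrite inE => /predU1P[->|abG] /=.
    by rewrite /merge eqxx; case: eqP.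
  by rewrite (pl_id pl abG).
- move=> U h hG; have [|h' hE] := pl_univ pl (h := h).
    by move=> ab abG; apply: hG; rewrite inE abG orbT.
  exists h' => u; rewrite -hE /merge; case: (m u =P _) => // ->.
  by rewrite !hE; apply: (hG (_, _)); rewrite mem_head.
Qed.

Section Placed.
Variables (D : diagram) (phi : dart K -> dart D) (tau lab : nat -> nat).
Variables (m : region K -> region D) (G : seq (nat * nat)).
Hypothesis pl : placed phi tau lab m G.

Let X : {set dart K} := [set d | d \notin s].
Local Notation C := (connect (strand (phi @: X))).
Local Notation anch := (anchor n I eps tau).

Let strand_edge x : C (phi x) (phi (edge x)).
Proof. by apply: connect1; rewrite /strand /= (pl_edge pl) eqxx. Qed.

Let memX x : (phi x \in phi @: X) = (x \notin s).
Proof. by rewrite (mem_imset _ _ (pl_inj pl)) inE. Qed.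

Let strand_tau k : k < n -> C (phi (v k)) (phi (v (tau k))).
Proof.
move=> kn; have [_ /eqP e1] := andP (pl_tau pl kn).
by apply: connect1; rewrite /strand /= memX mem_nth //= e1 eqxx orbT.
Qed.

Let walk_connect m' k j : k < n -> j \in walk I eps tau m' k ->
  (j < n) && C (phi (v k)) (phi (v j)).
Proof.
elim: m' k => [|m' IH] k kn /=; rewrite inE.
  by move=> /eqP ->; rewrite kn connect0.
case/predU1P=> [->|]; first by rewrite kn connect0.
have [t1 _] := andP (pl_tau pl kn); have kt := strand_tau kn.
case: ifP => tI; last by rewrite inE => /eqP ->; rewrite t1.
rewrite inE => /predU1P[->|]; first by rewrite t1.
have [_ eI eE] := fr_int fr tI; have [en _ _] := fr_int fr eI.
case/(IH _ en)/andP=> -> jC /=; apply: connect_trans kt (connect_trans _ jC).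
by rewrite -eE; apply: strand_edge.
Qed.

Lemma chain_connect k j : k < n -> j \in chain n I eps tau k ->
  (j < n) && C (phi (v k)) (phi (v j)).
Proof.
move=> kn; rewrite mem_cat => /orP[]; first exact: walk_connect.
case: ifP => // kI; have [_ eI eE] := fr_int fr kI; have [en _ _] := fr_int fr eI.
case/(walk_connect en)/andP=> -> jC /=; apply: connect_trans jC.
by rewrite -eE; apply: strand_edge.
Qed.

Lemma anchorP k : anch k < n ->
  (anch k \notin I) && (anch k \in chain n I eps tau k).
Proof.
move=> an; have := @nth_find _ 0
  (fun j => (j \notin I) && (j \in chain n I eps tau k)) (iota 0 n).
by rewrite has_find size_iota nth_iota //; apply.
Qed.

(** The strands seen from outside: edges not inside the disc, and pairs of boundary ends with equal
    anchors. No diagram but [K] occurs in it, so two pictures with the same anchors can be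
    compared. *)
Definition ext_rel : rel (dart K) := [rel a b |
  (a \notin internal) && (b == edge a) ||
  [&& a \in s, b \in s, a \notin internal, b \notin internal
    & anchor n I eps tau (index a s) == anchor n I eps tau (index b s)]].

Variable b : bool.
Hypothesis ok : pairing_ok n I eps b tau.

Let okP k : k < n ->
  [/\ tau k < n, tau (tau k) = k, tau k != k & anch (tau k) = anch k] /\
  [/\ k \in I -> anch (eps k) = anch k, anch k < n -> anch (anch k) = anch k
    & if b && (k \in I) then (0 \in chain n I eps tau k) && (tau k \in I)
      else anch k < n].
Proof.
move=> kn; have := allP ok k; rewrite mem_iota kn => /(_ isT).
case/and5P=> h1 /eqP h2 h3 /eqP h4 /and3P[/implyP h5 /implyP h6 h7].
by split=> //; split=> // [/h5|/h6] /eqP.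
Qed.

Let sP x : x \in s -> exists2 k, k < n & x = v k.
Proof. by move=> xs; exists (index x s); rewrite ?index_mem ?nth_index. Qed.

Let vI k : k < n -> (v k \in internal) = (k \in I).
Proof.
move=> kn; rewrite inE; apply/mapP/idP => [[j jI /eqP]|kI]; last by exists k.
by have [jn _ _] := fr_int fr jI; rewrite nth_uniq ?(fr_uniq fr) // => /eqP ->.
Qed.

(** An internal dart is pushed to the end of its strand on the boundary, or to the default [x0] if
    the strand is a circle inside the disc. This retraction turns paths of [strand] into paths of
    [ext_rel]. *)
Let proj x := if x \in internal then v (anch (index x s)) else x.

Let edgeK : involutive (@edge K). Proof. by case: (fr_good fr). Qed.

Let edge_int x : (edge x \in internal) = (x \in internal).
Proof.
have half y : y \in internal -> edge y \in internal.
  rewrite !inE => /mapP[k kI ->].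
  by have [_ eI ->] := fr_int fr kI; apply: map_f.
by apply/idP/idP => /half //; rewrite edgeK.
Qed.

Let ext_anchor j k : j < n -> k < n -> anch j = anch k ->
  connect ext_rel (proj (v j)) (proj (v k)).
Proof.
have pE i : i < n -> proj (v i) = v (if i \in I then anch i else i).
  by move=> ln; rewrite /proj vI // index_uniq ?(fr_uniq fr) //; case: ifP.
move=> jn kn jk; rewrite !pE //.
have [aj|aj] := ltnP (anch j) n; last first.
  have int i : i < n -> n <= anch i -> i \in I.
    move=> ln; rewrite leqNgt; apply: contraR => iI.
    by have [_ [_ _]] := okP ln; rewrite (negPf iI) andbF.
  by rewrite !int // -?jk // connect0.
have ak : anch k < n by rewrite -jk.
have ex i : i < n -> anch i < n -> let i' := if i \in I then anch i else i in
    [/\ i' < n, i' \notin I & anch i' = anch i].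
  move=> ln an /=; have [aI _] := andP (anchorP an).
  by have [_ [_ aa _]] := okP ln; case: ifP => [_|/negbT iI]; split; rewrite ?aa.
have [jn' jI' ja] := ex j jn aj; have [kn' kI' ka] := ex k kn ak.
apply: connect1; apply/orP; right; rewrite !mem_nth // !vI // jI' kI' /=.
by rewrite !index_uniq ?(fr_uniq fr) // ja ka jk.
Qed.

Lemma placed_off y : y \notin phi @: X -> (turn (turn y) == y) && (turn y != y).
Proof.
have [x ->] := pl_surj pl y; rewrite memX negbK => /sP[k kn ->].
have [[t1 t2 t3 _] _] := okP kn.
have [_ /eqP e1] := andP (pl_tau pl kn); have [_ /eqP e2] := andP (pl_tau pl t1).
by rewrite e1 e2 t2 eqxx (inj_eq (pl_inj pl)) nth_uniq ?(fr_uniq fr).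
Qed.

Let C_sym u w : C u w = C w u.
Proof.
apply: sym_connect_sym => {u w} u w; rewrite /strand /=; congr (_ || _).
  have [x ->] := pl_surj pl u; have [y ->] := pl_surj pl w.
  rewrite !(pl_edge pl) !(inj_eq (pl_inj pl)).
  by apply/eqP/eqP => ->; rewrite edgeK.
have half x y : (x \notin phi @: X) && (y == turn x) ->
    (y \notin phi @: X) && (x == turn y).
  case/andP=> xX /eqP ->; have /andP[/eqP -> _] := placed_off xX.
  rewrite eqxx andbT; move: xX; have [z ->] := pl_surj pl x.
  rewrite memX negbK => /sP[k kn ->]; have [t1 /eqP ->] := andP (pl_tau pl kn).
  by rewrite memX mem_nth.
by apply/idP/idP; apply: half.
Qed.

Lemma placed_ext x y : x \notin internal -> y \notin internal ->
  C (phi x) (phi y) = connect ext_rel x y.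
Proof.
move=> xP yP; apply/idP/idP; last first.
  apply: connect_img => {xP yP}u w /orP[/andP[_ /eqP ->]|]; first exact: strand_edge.
  case/and5P=> /sP[j jn ->] /sP[k kn ->]; rewrite !vI // => jI kI.
  rewrite !index_uniq ?(fr_uniq fr) // => /eqP jk.
  have aP i : i < n -> i \notin I -> C (phi (v i)) (phi (v (anch i))).
    move=> ln iI; have [_ [_ _]] := okP ln; rewrite (negPf iI) andbF => an.
    by have [_ /(chain_connect ln)/andP[]] := andP (anchorP an).
  apply: connect_trans (aP _ jn jI) _; rewrite C_sym.
  by rewrite jk; apply: aP.
have projE z : z \notin internal -> proj z = z by rewrite /proj => /negPf ->.
rewrite -{2}(projE x) // -{2}(projE y) //.
have [psi psiE] : exists psi, forall z, psi (phi z) = proj z.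
  by apply: (factor_through x) => u w /(pl_inj pl) ->.
rewrite -!psiE; apply: connect_img => {xP yP}u w; rewrite /strand /=.
have [{}u ->] := pl_surj pl u; case/orP=> [/eqP ->|/andP[]]; last first.
  rewrite memX negbK => /sP[k kn ->] /eqP ->.
  have [_ /eqP ->] := andP (pl_tau pl kn); have [[t1 _ _ ta] _] := okP kn.
  by rewrite !psiE; apply: ext_anchor.
rewrite (pl_edge pl) !psiE; have [uI|uI] := boolP (u \in internal); last first.
  by rewrite !projE ?edge_int //; apply: connect1; rewrite /ext_rel /= uI eqxx.
have /mapP[k kI uE] : u \in map v I by move: uI; rewrite inE.
have [kn eI eE] := fr_int fr kI; have [en _ _] := fr_int fr eI.
have [_ [ae _ _]] := okP kn.
by rewrite uE eE; apply: ext_anchor => //; rewrite ae.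
Qed.

Lemma placed_cover z : exists2 x, z = phi x & (b && (x \in internal))
  \/ exists2 p, p \notin internal & C (phi p) (phi x).
Proof.
have [x ->] := pl_surj pl z; exists x => //.
have [xI|xI] := boolP (x \in internal); last by right; exists x; rewrite // connect0.
have /mapP[k kI xE] : x \in map v I by move: xI; rewrite inE.
have [kn _ _] := fr_int fr kI; rewrite xE.
have [_ [_ _]] := okP kn; rewrite kI !andbT; case: b => [|an]; first by left.
right; exists (v (anch k)); first by rewrite vI //; have [] := andP (anchorP an).
by rewrite C_sym; have [_ /(chain_connect kn)/andP[]] := andP (anchorP an).
Qed.

Lemma placed_circle : b -> 0 \in I ->
  phi @: internal = [set w | connect (strand (phi @: X)) (phi (v 0)) w].
Proof.
move=> bT I0; apply/setP=> w; apply/imsetP/idP.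
  case=> x xI ->; have /mapP[k kI ->] : x \in map v I by move: xI; rewrite inE.
  have [kn _ _] := fr_int fr kI.
  have [_ [_ _]] := okP kn; rewrite bT kI /= => /andP[c0 _].
  by rewrite inE C_sym; have /andP[] := chain_connect kn c0.
rewrite inE => /connectP[q qP ->].
have : v 0 \in internal by rewrite inE map_f.
elim: q (v 0) qP => [|y q IH] x /=; first by exists x.
case/andP=> xy qP xI; suff [x' x'I yE] : exists2 x', x' \in internal & y = phi x'.
  by rewrite yE in qP *; apply: IH qP x'I.
case/orP: xy => [/eqP ->|/andP[_ /eqP ->]].
  by exists (edge x); rewrite ?edge_int ?(pl_edge pl).
have /mapP[k kI xE] : x \in map v I by move: xI; rewrite inE.
have [kn _ _] := fr_int fr kI; have [_ [_ _]] := okP kn; rewrite bT kI /=.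
case/andP=> _ tI; exists (v (tau k)); first by rewrite inE map_f.
by rewrite xE; have /andP[_ /eqP] := pl_tau pl kn.
Qed.

End Placed.
End Frame.

(** * Comparison of two pictures in one disc *)

Section Comparison.
Variables (K : diagram) (s : seq (dart K)) (I : seq nat) (eps : nat -> nat).
Variables (x0 : dart K) (rs : seq (region K)) (r0 : region K).
Hypothesis fr : frame s I eps x0 rs r0.

Notation v := (nth x0 s).
Notation n := (size s).
Notation label := (label rs r0).
Notation internal := (internal s I x0).
Notation placed := (placed s I x0 rs r0).

Lemma part_id (R : eqType) (G : seq (nat * nat)) (m : region K -> R) :
  {in G, forall ab, m (label ab.1) = m (label ab.2)} ->
  forall a, m (label (part G a)) = m (label a).
Proof.
elim: G => //= ab G IH mG a.
have mG' : {in G, forall ab, m (label ab.1) = m (label ab.2)}.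
  by move=> cd cdG; apply: mG; rewrite inE cdG orbT.
rewrite /merge; case: eqP => aE; rewrite IH //.
by rewrite mG ?mem_head // -(IH mG' ab.2) -aE IH.
Qed.

Definition refill_region (c : nat) (u : region K) : region K :=
  if u == label 0 then label c else u.

Lemma refill_label c a : refill_region c (label a) = label (refill c a).
Proof.
rewrite /refill_region /refill; case: (eqVneq a 0) => [->|]; first by rewrite eqxx.
by rewrite -lt0n => /(fr_label fr)/negPf ->.
Qed.

(** The universal property of [m1] is applied to [m2] after the refilling of the empty region;
    [refines] says that the pairs in [G1] are then respected. *)
Lemma refines_region (R1 R2 : finType) (m1 : region K -> R1)
    (m2 : region K -> R2) (G1 G2 : seq (nat * nat)) c :
  (forall (U : finType) (h : region K -> U),
    {in G1, forall ab, h (label ab.1) = h (label ab.2)} ->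
    exists h' : R1 -> U, forall u, h' (m1 u) = h u) ->
  {in G2, forall ab, m2 (label ab.1) = m2 (label ab.2)} ->
  refines c G1 G2 -> exists h, forall u, h (m1 u) = m2 (refill_region c u).
Proof.
move=> univ id2 /allP ref; apply: univ => ab abG.
rewrite !refill_label -(part_id id2) (eqP (ref _ abG)).
by rewrite (part_id id2).
Qed.

Section Two.
Variables (D1 D2 : diagram) (phi1 : dart K -> dart D1) (phi2 : dart K -> dart D2).
Variables (tau1 tau2 lab1 lab2 : nat -> nat) (G1 G2 : seq (nat * nat)).
Variables (m1 : region K -> region D1) (m2 : region K -> region D2).
Hypothesis (pl1 : placed phi1 tau1 lab1 m1 G1).
Hypothesis (pl2 : placed phi2 tau2 lab2 m2 G2).
Hypotheses (g1 : good D1) (g2 : good D2).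

Lemma placed_equiv b : check n I eps b lab1 tau1 G1 tau2 G2 -> local_equiv b D1 D2.
Proof.
case/and5P=> ok1 ok2 /allP anch12 /hasP[c1 _ /andP[ref1 circ]] /hasP[c2 _ ref2].
split=> //.
have [h hE] := refines_region (pl_univ pl1) (pl_id pl2) ref1.
have [k kE] := refines_region (pl_univ pl2) (pl_id pl1) ref2.
have [psi psiK] : exists psi, forall x, psi (phi2 x) = x.
  by apply: (factor_through x0) => x y /(pl_inj pl2).
(* [X] consists of the darts at the vertices outside of the disc; [P] adds the ends of the strands
   on its boundary. *)
pose X := [set d : dart K | d \notin s]; pose P := ~: internal.
pose phi z := phi1 (psi z).
have phiE x : phi (phi2 x) = phi1 x by rewrite /phi psiK.
have phiX : phi @: (phi2 @: X) = phi1 @: X.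
  by rewrite -imset_comp; apply: eq_imset => x /=; rewrite phiE.
have [/andP[ri ro] rP] := (fr_io fr, fr_reg fr).
have fillP x : x \notin internal -> refill_region c1 (reg x) = reg x
    /\ refill_region c2 (reg x) = reg x.
  by move=> /rP/negPf xr; rewrite /refill_region !xr.
have fill_io : [/\ refill_region c1 (inner K) = inner K,
    refill_region c2 (inner K) = inner K, refill_region c1 (outer K) = outer K
    & refill_region c2 (outer K) = outer K].
  by rewrite /refill_region (negPf ri) (negPf ro).
have intE x : x \in internal -> exists2 j, j \in I & x = v j.
  by rewrite inE => /mapP.
have edge_int x : x \notin internal -> edge x \notin internal.
  have [eK _ _ _ _] := fr_good fr.
  apply: contra => /intE[j jI /(congr1 (@edge K))]; rewrite eK => ->.
  by have [_ eI ->] := fr_int fr jI; rewrite inE map_f.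
have ext12 : ext_rel s I eps x0 tau1 =2 ext_rel s I eps x0 tau2.
  move=> x y; rewrite /ext_rel /=; congr (_ || _).
  case xs: (x \in s) => //=; case ys: (y \in s) => //=.
  case xI: (x \in internal) => //=; case yI: (y \in internal) => //=.
  have aE z : z \in s -> (z \in internal) = false ->
      anchor n I eps tau1 (index z s) = anchor n I eps tau2 (index z s).
    move=> zs zI; apply/eqP; have := anch12 (index z s).
    rewrite mem_iota index_mem zs => /(_ isT)/orP[] // iI.
    by move: zI; rewrite inE -(nth_index x0 zs) map_f.
  by rewrite !aE.
exists phi, (phi2 @: X), (phi2 @: P), (if b then phi1 @: internal else set0).
exists (m1 (label 0)), h, k; split.
  split; rewrite ?phiX.
  - move=> _ _ /imsetP[x _ ->] /imsetP[y _ ->].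
    by rewrite !phiE => /(pl_inj pl1) ->.
  - apply: imsetS; apply/subsetP=> x; rewrite !inE; apply: contra => /mapP[j jI ->].
    by have [jn _ _] := fr_int fr jI; apply: mem_nth.
  - move=> _ /imsetP[x xX ->]; move: xX; rewrite inE => xs; rewrite (pl_turn pl2) //.
    by rewrite imset_f // inE (fr_turn fr).
  - move=> _ /imsetP[x xX ->]; move: xX; rewrite inE => xs.
    by rewrite (pl_turn pl2) // !phiE (pl_turn pl1).
  - move=> _ /imsetP[x xX ->] _; move: xX; rewrite inE => xs.
    by rewrite phiE (pl_over pl1) // (pl_over pl2).
  - exact: (placed_off fr pl2 ok2).
  - exact: (placed_off fr pl1 ok1).
  - move=> _ _ /imsetP[x xP ->] /imsetP[y yP ->]; rewrite !phiE.
    move: xP yP; rewrite !in_setC => xP yP.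
    rewrite (placed_ext fr pl1 ok1) // (placed_ext fr pl2 ok2) //.
    exact: eq_connect.
  - move=> y; have [x -> [//|[p pP px]]] := placed_cover fr pl2 ok2 y.
    by exists (phi2 p); rewrite // imset_f // in_setC.
  - move=> z zN; have [x zx [/andP[bT xI]|[p pP px]]] := placed_cover fr pl1 ok1 z.
      by move: zN; rewrite bT zx imset_f.
    by exists (phi2 p); rewrite ?imset_f ?in_setC // phiE zx.
  - move=> _ /imsetP[x xP ->]; rewrite phiE (pl_edge pl1) (pl_edge pl2).
    move: xP; rewrite in_setC => xP; have exP := edge_int _ xP.
    rewrite !(pl_reg pl1) // !(pl_reg pl2) // !hE.
    by have [-> _] := fillP _ xP; have [-> _] := fillP _ exP.
  - move=> _ /imsetP[x xP ->]; rewrite phiE (pl_edge pl1) (pl_edge pl2).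
    move: xP; rewrite in_setC => xP; have exP := edge_int _ xP.
    rewrite !(pl_reg pl1) // !(pl_reg pl2) // !kE.
    by have [_ ->] := fillP _ xP; have [_ ->] := fillP _ exP.
  - have [-> ->] := pl_io pl1; have [-> ->] := pl_io pl2; rewrite !hE.
    by have [-> _ -> _] := fill_io.
  - have [-> ->] := pl_io pl1; have [-> ->] := pl_io pl2; rewrite !kE.
    by have [_ -> _ ->] := fill_io.
case bT: b => //; move: circ; rewrite bT => /and3P[I0 /allP nz /allP circ].
(* Label [0] occurs in no pair of [G1], so the test for being the empty region factors through
   [m1]. *)
have m0 u : (m1 u == m1 (label 0)) = (u == label 0).
  have [|h' h'E] := pl_univ pl1 (h := fun u => u == label 0).
    move=> ab /nz/andP[]; rewrite -!lt0n => /(fr_label fr)/negPf ->.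
    by move/(fr_label fr)/negPf ->.
  apply/eqP/eqP => [um|->] //; apply/eqP.
  by have := h'E u; rewrite um h'E eqxx => <-.
have circE j : j \in I -> [/\ reg (phi1 (v j)) = m1 (label (lab1 j)),
    reg (edge (phi1 (v j))) = m1 (label (lab1 (eps j)))
    & (lab1 j == 0) (+) (lab1 (eps j) == 0)] /\
    part G2 (refill c1 (lab1 j)) = part G2 (refill c1 (lab1 (eps j))).
  move=> jI; have [jn eI eE] := fr_int fr jI; have [en _ _] := fr_int fr eI.
  have /andP[h1 /eqP h2] := circ _ jI; split=> //; split=> //.
    exact: (pl_lab pl1).
  by rewrite (pl_edge pl1) eE; apply: (pl_lab pl1).
have lab0 a : (label a == label 0) = (a == 0).
  case: (eqVneq a 0) => [->|]; first by rewrite eqxx.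
  by rewrite -lt0n => /(fr_label fr)/negPf.
split; rewrite ?phiX.
- by exists (phi1 (v 0)); apply: (placed_circle fr pl1 ok1).
- move=> _ /imsetP[x xP ->]; rewrite phiE (mem_imset _ _ (pl_inj pl1)).
  by rewrite -in_setC.
- move=> _ /imsetP[x /intE[j jI ->] ->].
  have [[-> -> _] pE] := circE j jI; rewrite !hE !refill_label.
  by rewrite -(part_id (pl_id pl2)) pE (part_id (pl_id pl2)).
- move=> z; have [x ->] := pl_surj pl1 z; rewrite (mem_imset _ _ (pl_inj pl1)).
  have [xI|xI] := boolP (x \in internal).
    have [j jI ->] := intE x xI; have [[-> -> jE] _] := circE j jI.
    by rewrite !m0 !lab0.
  rewrite (pl_edge pl1) !(pl_reg pl1) ?edge_int // !m0.
  by rewrite !(negPf (rP _ _)) ?edge_int.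
- by have [-> ->] := pl_io pl1; rewrite !m0.
- move=> _ /imsetP[x xP ->]; rewrite phiE; move: xP; rewrite in_setC => xP.
  by rewrite (pl_reg pl1) // m0 rP.
Qed.

End Two.
End Comparison.

(** * Weights and iterated smoothings *)

Lemma weight_neq0 (D : diagram) (c : dart D) : weight c != 0%R.
Proof.
rewrite /weight; case: ifP => _; first exact: A_neq0.
by apply: invr_neq0; apply: A_neq0.
Qed.

Lemma d_loop_weight (D : diagram) (c : dart D) :
  d_loop = (- weight c ^+ 2 - (weight c)^-1 ^+ 2)%R.
Proof.
rewrite /d_loop /weight; move: A => a; case: ifP => _; first by rewrite exprVn.
by rewrite invrK exprVn [RHS]addrC.
Qed.

(** The weights at the two crossings of a bigon are inverse to each other. Here [x] is the state
    with the strands pulled apart, and [y] gets the coefficient [w ^+ 2 + w^-1 ^+ 2 + d]. *)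
Lemma bigon_cancel (F : fieldType) (V : lmodType F) (w d : F) (x y : V) :
  (w != 0 -> d = - w ^+ 2 - w^-1 ^+ 2 ->
  w *: (w^-1 *: x + w^-1^-1 *: y) + w^-1 *: (w^-1 *: y + w^-1^-1 *: (d *: y))
  = x)%R.
Proof.
move=> w0 ->; rewrite !scalerDr !scalerA -addrA divff // scale1r.
rewrite -!scalerDl [X in (X *: y)%R](_ : _ = 0)%R ?scale0r ?addr0 //.
by field; rewrite w0 oner_eq0.
Qed.

(* the rotation of a numbered dart at a crossing *)
Definition spin (k : nat) : nat := 4 * (k %/ 4) + k.+1 %% 4.

Section PlacedSelf.
Variables (K : diagram) (s : seq (dart K)) (I : seq nat) (eps : nat -> nat).
Variables (x0 : dart K) (rs : seq (region K)) (r0 : region K).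
Notation v := (nth x0 s).
Notation n := (size s).
Notation placed := (placed s I x0 rs r0).

Lemma placed_self lab :
  (forall k, k < n -> (spin k < n) && (turn (v k) == v (spin k))) ->
  (forall k, k < n -> reg (v k) = label rs r0 (lab k)) ->
  @placed K id spin lab id [::].
Proof. by move=> tE rE; split=> //; [move=> z; exists z | move=> U h _; exists h]. Qed.

(** The darts of [K] name the darts of all diagrams derived from it, which makes a sequence of
    smoothings a list of indices. *)
Record marking := Marking { marked : diagram; mark : dart K -> dart marked }.

Fixpoint smooth_all (x : marking) (js : seq nat) : marking :=
  if js is j :: js' then
    smooth_all (@Marking (smooth (mark x (v j))) (mark x)) js' else x.

Fixpoint turn_all (tau : nat -> nat) (js : seq nat) : nat -> nat :=
  if js is j :: js' then turn_all (smooth_turn n tau j) js' else tau.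

Fixpoint glue_all (lab tau : nat -> nat) (G : seq (nat * nat)) (js : seq nat) :
    seq (nat * nat) :=
  if js is j :: js' then
    glue_all lab (smooth_turn n tau j) ((lab j, lab (tau (tau j))) :: G) js' else G.

Fixpoint can_smooth (tau : nat -> nat) (js : seq nat) : bool :=
  if js is j :: js' then
    [&& j < n, tau (tau j) != j & can_smooth (smooth_turn n tau j) js'] else true.

Hypothesis fr : frame s I eps x0 rs r0.

Lemma placed_crossing D (phi : dart K -> dart D) tau lab m G j :
  @placed D phi tau lab m G -> j < n ->
  crossing (phi (v j)) = (tau (tau j) != j).
Proof.
move=> pl jn; have [t1 /eqP e1] := andP (pl_tau pl jn).
have [t2 /eqP e2] := andP (pl_tau pl t1).
by rewrite /crossing e1 e2 (inj_eq (pl_inj pl)) nth_uniq ?(fr_uniq fr).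
Qed.

Lemma placed_smooth_all x tau lab m G js :
  @placed (marked x) (mark x) tau lab m G -> good (marked x) ->
  can_smooth tau js ->
  good (marked (smooth_all x js)) /\
  exists m', @placed _ (mark (smooth_all x js)) (turn_all tau js) lab m'
    (glue_all lab tau G js).
Proof.
elim: js x tau m G => [|j js IH] x tau m G pl gx /=; first by split=> //; exists m.
case/and3P=> jn jc cs; apply: (IH (@Marking (smooth (mark x (v j))) (mark x))) cs.
  exact: (placed_smooth fr pl jn).
by apply: good_smooth; rewrite // (placed_crossing pl).
Qed.

(** Every comparison of local states in the Reidemeister moves is an instance; the last hypothesis
    is closed by evaluation. *)
Lemma equiv_smooth_all (B : lmodType Laurent) (val : nat -> nat -> nat -> B) b
    x1 x2 tau1 tau2 lab1 lab2 m1 m2 G1 G2 js1 js2 :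
  @placed (marked x1) (mark x1) tau1 lab1 m1 G1 -> good (marked x1) ->
  @placed (marked x2) (mark x2) tau2 lab2 m2 G2 -> good (marked x2) ->
  [&& can_smooth tau1 js1, can_smooth tau2 js2
    & check n I eps b lab1 (turn_all tau1 js1) (glue_all lab1 tau1 G1 js1)
        (turn_all tau2 js2) (glue_all lab2 tau2 G2 js2)] ->
  bracket val (marked (smooth_all x1 js1))
  = (d_loop ^+ b *: bracket val (marked (smooth_all x2 js2)))%R.
Proof.
move=> pl1 g1 pl2 g2 /and3P[c1 c2 ck].
have [g1' [m1' pl1']] := placed_smooth_all pl1 g1 c1.
have [g2' [m2' pl2']] := placed_smooth_all pl2 g2 c2.
exact/local_equiv_bracket/(placed_equiv fr pl1' pl2').
Qed.

Lemma skein_smooth_all (B : lmodType Laurent) (val : nat -> nat -> nat -> B)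
    x tau lab m G js j :
  @placed (marked x) (mark x) tau lab m G -> good (marked x) ->
  can_smooth tau (rcons js j) ->
  bracket val (marked (smooth_all x js))
  = (weight (mark x (v j)) *: bracket val (marked (smooth_all x (rcons js j)))
     + (weight (mark x (v j)))^-1 *:
       bracket val (marked (smooth_all x (rcons js (turn_all tau js j)))))%R.
Proof.
elim: js x tau m G => [|i js IH] x tau m G pl gx /=.
  case/and3P=> jn jc _; rewrite (skein val gx (c := mark x (v j))).
    by have [_ /eqP ->] := andP (pl_tau pl jn).
  by rewrite (placed_crossing pl).
case/and3P=> ln lc cs; apply: (IH (@Marking (smooth (mark x (v i))) (mark x))) cs.
  exact: (placed_smooth fr pl ln).
by apply: good_smooth; rewrite // (placed_crossing pl).
Qed.

End PlacedSelf.

Section Vertices.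
Variables (D : diagram).
Hypothesis gD : good D.

Lemma vertex_turn (c d : dart D) : (turn d \in vertex c) = (d \in vertex c).
Proof. exact: (Skein.orb_turn (turn4 gD)). Qed.

Lemma vertex_uniq (c : dart D) : crossing c -> uniq (vertex c).
Proof.
move=> hc; have tI := turn_injective gD.
have h0 : (c == turn (turn c)) = false by rewrite eq_sym (negPf hc).
have h1 : (c == turn c) = false.
  by apply: contraFF h0 => /eqP h; rewrite -!h.
have h3 : (c == turn (turn (turn c))) = false.
  by apply: contraFF h1 => /eqP h; rewrite [in turn c]h turn4.
by rewrite /= !inE !(inj_eq tI) h0 h1 h3.
Qed.

Lemma vertex_disjoint (c d : dart D) : d \notin vertex c ->
  ~~ has [in vertex c] (vertex d).
Proof.
move=> dc; apply/hasPn=> x xd; apply: contra dc => xc.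
by rewrite -(Skein.orb_trans (turn4 gD) c (xd : x \in Skein.orb _ d)).
Qed.

End Vertices.

Lemma vertex_cat_uniq (D : diagram) (p q : dart D) : good D ->
  crossing p -> crossing q -> q \notin vertex p -> uniq (vertex p ++ vertex q).
Proof.
by move=> gD hp hq qp; rewrite cat_uniq !vertex_uniq // vertex_disjoint.
Qed.

(** * Reidemeister moves *)

Section R1Move.
Variables (K : odiagram) (l : dart K).
Hypotheses (gK : good K) (site : R1_site l).

Let eps1 k := 1 - k.
Let rs := [:: reg l; reg (turn l); reg (turn (turn l))].

Lemma R1_frame : frame (vertex l) [:: 0; 1] eps1 l rs (inner K).
Proof.
have [hl el [emp il ol]] := site; have [eK _ _ [fE _] _] := gK.
have ul := vertex_uniq gK hl; have [] := ul.
rewrite /= !inE !negb_or => /and3P[/and3P[l1 l2 l3] _ _].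
split=> //.
- by move=> d; rewrite vertex_turn.
- by move=> k; rewrite !inE => /orP[] /eqP -> /=; rewrite -?el ?eK.
- by move=> d; rewrite inE /= !inE negb_or emp mem_seq1 => /andP[].
- by rewrite il ol.
- case=> // -[|[|a]] _; rewrite /label /= ?nth_nil // emp mem_seq1 eq_sym //.
Qed.

Let lab1 := nth 0 [:: 0; 1; 2; 1].

Lemma R1_reg3 : reg (turn (turn (turn l))) = reg (turn l).
Proof.
have [hl el _] := site; have [_ _ _ [fE _] _] := gK.
by rewrite -fE turn4 // el.
Qed.

Lemma R1_placed :
  placed (vertex l) [:: 0; 1] l rs (inner K) (D := K) id spin lab1 id [::].
Proof.
apply: placed_self => -[|[|[|[|k]]]] //= _; rewrite ?turn4 //.
exact: R1_reg3.
Qed.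

Lemma R1_placed' : placed (vertex l) [:: 0; 1] l rs (inner K) (D := R1 l) id
  (fun k => (k + 2) %% 4) (nth 0 [:: 1; 2; 2; 1]) id [::].
Proof.
have [hl el _] := site; have ul := vertex_uniq gK hl.
move: (ul); rewrite /= !inE !negb_or => /and3P[/and3P[l1 l2 l3] /andP[l12 l13] _].
split=> //; try by [move=> z; exists z | move=> U h _; exists h].
- by move=> x /= /negPf ->.
- by move=> [|[|[|[|k]]]] //= _; rewrite !inE ?eqxx ?orbT ?turn4.
- by move=> x; rewrite inE /= !inE negb_or => /andP[/negPf -> /negPf ->].
- move=> [|[|[|[|k]]]] //= _; rewrite ?eqxx //.
  + by rewrite eq_sym (negPf l1).
  + by rewrite eq_sym (negPf l2) eq_sym (negPf l12).
  + by rewrite eq_sym (negPf l3) eq_sym (negPf l13) R1_reg3.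
Qed.

Lemma R1_bracket (B : lmodType Laurent) (val : nat -> nat -> nat -> B) :
  good (R1 l) ->
  bracket val K
  = ((weight (D := K) l + (weight (D := K) l)^-1 * d_loop) *: bracket val (R1 l))%R.
Proof.
move=> gR; have [fr pl pl'] := And3 R1_frame R1_placed R1_placed'.
pose x := Marking (@id (dart K)).
pose x' := @Marking K (R1 l) id.
rewrite -[LHS]/(bracket val (marked (smooth_all (vertex l) l x [::]))).
rewrite (skein_smooth_all fr val (x := x) (js := [::]) (j := 0) pl gK isT).
(* Smoothing at [l] opens the monogon and leaves the straight strand; smoothing at [turn l] closes
   the loop up into a circle. *)
rewrite (equiv_smooth_all fr val (b := false) (x1 := x) (js1 := [:: 0])
  (x2 := x') (js2 := [::]) pl gK pl' gR isT).
rewrite (equiv_smooth_all fr val (b := true) (x1 := x) (js1 := [:: 1])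
  (x2 := x') (js2 := [::]) pl gK pl' gR isT).
by rewrite expr0 expr1 scale1r scalerA -scalerDl.
Qed.

End R1Move.

Section R2Move.
Variables (K : odiagram) (p q : dart K).
Hypotheses (gK : good K) (site : R2_site p q).

Let eps2 k := nth 0 [:: 5; 4; 0; 0; 1; 0] k.
Let s2 := vertex p ++ vertex q.
Let I2 := [:: 0; 1; 4; 5].
(** The bigon, the regions opposite to it at [p] and at [q], and those beyond its sides from
    [turn q] to [p] and from [turn p] to [q]. *)
Let rs := [:: reg p; reg (turn (turn p)); reg (turn (turn q));
  reg (turn q); reg (turn p)].
Let lab2 := nth 0 [:: 0; 4; 1; 3; 0; 3; 2; 4].

Let us : uniq s2.
Proof. by have [[hp hq qp] _ _ _ _] := site; apply: vertex_cat_uniq. Qed.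

Let idx j k : j < 8 -> k < 8 -> (nth p s2 j == nth p s2 k) = (j == k).
Proof. by move=> jn kn; rewrite nth_uniq. Qed.

Lemma R2_frame : frame s2 I2 eps2 p rs (inner K).
Proof.
have [_ e1 e2 _ [emp ip op]] := site; have [eK _ _ _ _] := gK.
have x1 k : k < 8 -> (k != 0) -> (k != 4) -> (nth p s2 k \in [:: p; q]) = false.
  move=> kn k0 k4; rewrite !inE (idx (k := 0)) ?(idx (k := 4)) //.
  by rewrite (negPf k0) (negPf k4).
split=> //.
- by move=> d; rewrite !mem_cat !vertex_turn.
- move=> k; rewrite !inE => /or4P[] /eqP -> /=; split=> //.
  + by rewrite -e2 eK.
  + by rewrite -e1 eK.
- by move=> d; rewrite inE /= !inE !negb_or emp !inE negb_or => /and4P[-> _ -> _].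
- by rewrite ip op.
- case=> // -[|[|[|[|a]]]] _; rewrite /label /= ?nth_nil // emp.
  + by rewrite (x1 2).
  + by rewrite (x1 6).
  + by rewrite (x1 5).
  + by rewrite (x1 1).
Qed.

Lemma R2_placed : placed s2 I2 p rs (inner K) (D := K) id spin lab2 id [::].
Proof.
have [_ e1 e2 _ _] := site; have [eK _ _ [fE _] _] := gK.
have rq : reg q = reg p by rewrite -e1 fE.
have rp3 : reg (turn (turn (turn p))) = reg (turn q) 
  by rewrite -fE turn4 // -e2 eK.
have rq3 : reg (turn (turn (turn q))) = reg (turn p).
  by rewrite -fE turn4 // -e1 eK.
by apply: placed_self => -[|[|[|[|[|[|[|[|k]]]]]]]] //= _; rewrite ?turn4.
Qed.

Lemma R2_placed' : placed s2 I2 p rs (inner K) (D := R2 p q) id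
  (fun k => 4 * (k %/ 4) + (k + 2) %% 4) (nth 0 [:: 4; 1; 1; 3; 3; 2; 2; 4])
  (merge (reg (turn (turn p))) (reg (turn (turn q)))) [:: (1, 2)].
Proof.
have pl := R2_placed; have memE k : k < 8 -> (nth p s2 k \in [:: p; turn p; q; turn q])
    = (k \in [:: 0; 1; 4; 5]).
  move=> kn; rewrite !inE (idx (k := 0)) ?(idx (k := 1)) //.
  by rewrite (idx (k := 4)) ?(idx (k := 5)).
split=> //.
- by move=> z; exists z.
- by move=> x /= /negPf; rewrite /s2 /= => ->.
- move=> k kn /=; rewrite (mem_nth _ kn : _ \in vertex p ++ vertex q).
  by case: k kn => [|[|[|[|[|[|[|[|k]]]]]]]] //= _; rewrite ?turn4.
- move=> x xI /=; rewrite ifN //; apply: contra xI => xp.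
  by rewrite inE.
- move=> k kn; rewrite [LHS]/= memE //; congr merge.
  have rE := pl_lab pl.
  by case: k kn => [|[|[|[|[|[|[|[|k]]]]]]]] //= _;
    rewrite ?(rE 1) ?(rE 2) ?(rE 3) ?(rE 5) ?(rE 6) ?(rE 7).
- by move=> ab; rewrite inE => /eqP -> /=; rewrite /merge eqxx; case: eqP.
- move=> U h hG; exists h => u; rewrite /merge; case: eqP => // ->.
  by apply: (hG (1, 2)); rewrite mem_head.
Qed.

Lemma R2_bracket (B : lmodType Laurent) (val : nat -> nat -> nat -> B) :
  good (R2 p q) -> bracket val K = bracket val (R2 p q).
Proof.
move=> gR; have [[hp hq _] _ _ opq _] := site; have [_ _ oE _ _] := gK.
have [fr pl pl'] := And3 R2_frame R2_placed R2_placed'.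
pose x := Marking (@id (dart K)).
(* [b] is kept abstract, so that the linear algebra below does not see the diagrams. *)
have [b bE] : exists b : seq nat -> B, forall js,
    b js = bracket val (marked (smooth_all s2 p x js)) by eexists.
have sk js j := skein_smooth_all fr val (x := x) (js := js) (j := j) pl gK.
have eqv c js1 js2 := equiv_smooth_all fr val (b := c) (x1 := x) (x2 := x)
  (js1 := js1) (js2 := js2) pl gK pl gK.
have weq : weight (D := K) q = ((weight (D := K) p)^-1)%R.
  by rewrite /weight opq oE //; case: (over q); rewrite //= invrK.
rewrite -[LHS]/(bracket val (marked (smooth_all s2 p x [::]))).
(* Opening the bigon at both corners gives the two strands of the moved diagram. The three other
   states cut off a corner and all join the ends in the other way; cutting off both leaves a
   circle. *)
have e1 : b [:: 0; 4] = bracket val (R2 p q).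
  have := equiv_smooth_all fr val (b := false) (x1 := x) (js1 := [:: 0; 4])
    (x2 := @Marking K (R2 p q) id) (js2 := [::]) pl gK pl' gR.
  by rewrite bE scale1r; apply; vm_compute.
have e2 : b [:: 1; 4] = b [:: 0; 5].
  by have := eqv false [:: 1; 4] [:: 0; 5]; rewrite !bE scale1r; apply; vm_compute.
have e3 : b [:: 1; 5] = (d_loop *: b [:: 0; 5])%R.
  by have := eqv true [:: 1; 5] [:: 0; 5]; rewrite !bE expr1; apply; vm_compute.
have s0 : b [::] =
    (weight (D := K) p *: b [:: 0] + (weight (D := K) p)^-1 *: b [:: 1])%R.
  by rewrite !bE; apply: (sk [::] 0); vm_compute.
have s1 j : j \in [:: 0; 1] -> b [:: j]
    = (weight (D := K) q *: b [:: j; 4] + (weight (D := K) q)^-1 *: b [:: j; 5])%R.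
  rewrite !inE !bE => /orP[] /eqP ->; last by apply: (sk [:: 1] 4); vm_compute.
  by apply: (sk [:: 0] 4); vm_compute.
rewrite -bE s0 !s1 // weq e1 e2 e3.
exact: bigon_cancel (weight_neq0 _) (d_loop_weight _).
Qed.

End R2Move.

(* Of the eight states of a triangle, the one with a circle inside and the three
   which cut off two corners join the six ends in the same way. *)
Lemma triangle_coefficient (F : fieldType) (a d : F) (x y z : bool) :
  let f (c : bool) := (if c then a else a^-1)%R in
  (a != 0 -> d = - a ^+ 2 - a^-1 ^+ 2 -> ~~ ((x == y) && (y == z)) ->
  (f x)^-1 * (f y)^-1 * f z + (f x)^-1 * f y * (f z)^-1
  + f x * (f y)^-1 * (f z)^-1 + (f x)^-1 * (f y)^-1 * (f z)^-1 * d
  = f x * f y * f z)%R.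
Proof.
move=> f a0 ->; rewrite /f.
by case: x; case: y; case: z => //= _; rewrite ?invrK; field; rewrite ?a0 ?oner_eq0.
Qed.

(** The left side is the threefold skein expansion, a digit 1 standing for a corner cut off; all
    states with two such digits are replaced by [b110]. The hypothesis gives [b110] the coefficient
    of [b000], so that a move exchanging these two states leaves the sum unchanged. *)
Lemma triangle_cancel (F : fieldType) (V : lmodType F) (x y z d : F)
    (b000 b100 b010 b001 b110 : V) :
  (x^-1 * y^-1 * z + x^-1 * y * z^-1 + x * y^-1 * z^-1 + x^-1 * y^-1 * z^-1 * d
   = x * y * z ->
  x *: (y *: (z *: b000 + z^-1 *: b001) + y^-1 *: (z *: b010 + z^-1 *: b110))
  + x^-1 *: (y *: (z *: b100 + z^-1 *: b110)
    + y^-1 *: (z *: b110 + z^-1 *: (d *: b110)))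
  = (x * y * z) *: (b000 + b110) + (x^-1 * y * z) *: b100
    + (x * y^-1 * z) *: b010 + (x * y * z^-1) *: b001)%R.
Proof.
move=> cE; rewrite [in RHS]scalerDr -[in ((x * y * z) *: b110)%R]cE.
rewrite !scalerDl !scalerDr !scalerA !mulrA.
by rewrite !addrA [RHS](ACl (1*8*7*4*6*3*2*5)%AC).
Qed.

Definition smooth3 (D : diagram) (a b c : dart D) : diagram :=
  @smooth (@smooth (smooth a) b) c.

Section Triangle.
Variables (D : diagram) (p q r : dart D).
Hypotheses (gD : good D) (site : R3_site p q r).

Definition triangle_darts : seq (dart D) := vertex p ++ vertex q ++ vertex r.
Definition triangle_int := [:: 0; 1; 4; 5; 8; 9].
Definition triangle_edge := nth 0 [:: 9; 4; 0; 0; 1; 8; 0; 0; 5; 0].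
(* the triangle, the regions opposite to it at [p], [q] and [r], and the regions
   beyond its sides from [r] to [p], from [q] to [r] and from [p] to [q] *)
Definition triangle_regions : seq (region D) :=
  [:: reg p; reg (turn (turn p)); reg (turn (turn q)); reg (turn (turn r));
      reg (turn r); reg (turn q); reg (turn p)].
Definition triangle_label := nth 0 [:: 0; 6; 1; 4; 0; 5; 2; 6; 0; 4; 3; 5].

Notation s3 := triangle_darts.
Notation v := (nth p s3).

Lemma triangle_uniq : uniq s3.
Proof.
have [[hp hq hr] [qp rp rq] _ _ _] := site.
rewrite /s3 !cat_uniq has_cat negb_or !vertex_uniq // !vertex_disjoint //.
Qed.

Lemma triangle_idx j k : j < 12 -> k < 12 -> (v j == v k) = (j == k).
Proof. by move=> jn kn; rewrite nth_uniq // triangle_uniq. Qed.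

Lemma triangle_frame :
  frame s3 triangle_int triangle_edge p triangle_regions (inner D).
Proof.
have [_ _ [e1 e2 e3] _ [emp ip op]] := site; have [eK _ _ _ _] := gD.
have [f1 [f2 f3]] : edge q = turn p /\ edge r = turn q /\ edge p = turn r.
  by rewrite -[in LHS]e1 -[in edge r]e2 -[in edge p]e3 !eK.
have ext k : k < 12 -> k \notin [:: 0; 4; 8] -> reg (v k) != reg p.
  move=> kn; rewrite emp !inE (triangle_idx (k := 0)) // (triangle_idx (k := 4)) //.
  by rewrite (triangle_idx (k := 8)).
split=> //.
- exact: triangle_uniq.
- by move=> d; rewrite !mem_cat !vertex_turn.
- move=> k; rewrite !inE.
  by move=> /or4P[||| /or3P[]] /eqP -> /=; split; rewrite // ?e1 ?e2 ?e3 ?f1 ?f2 ?f3.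
- move=> d; rewrite inE /= !inE !negb_or emp !inE !negb_or.
  by case/and5P=> -> _ -> _ /andP[-> _].
- by rewrite ip op.
- case=> // -[|[|[|[|[|[|a]]]]]] _; rewrite /label /= ?nth_nil //.
  + exact: (ext 2).
  + exact: (ext 6).
  + exact: (ext 10).
  + exact: (ext 9).
  + exact: (ext 5).
  + exact: (ext 1).
Qed.

Lemma triangle_placed : placed s3 triangle_int p triangle_regions (inner D)
  id spin triangle_label id [::].
Proof.
have [_ _ [e1 e2 e3] _ _] := site; have [eK _ _ [fE _] _] := gD.
have rq : reg q = reg p by rewrite -e1 fE.
have rr : reg r = reg p by rewrite -e2 fE.
have rp3 : reg (turn (turn (turn p))) = reg (turn r).
  by rewrite -fE turn4 // -[in LHS]e3 eK.
have rq3 : reg (turn (turn (turn q))) = reg (turn p).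
  by rewrite -fE turn4 // -[in LHS]e1 eK.
have rr3 : reg (turn (turn (turn r))) = reg (turn q).
  by rewrite -fE turn4 // -[in LHS]e2 eK.
apply: placed_self.
- by do 12?[case=> //=]; rewrite ?turn4.
- by do 12?[case=> //=].
Qed.

Lemma triangle_bracket (B : lmodType Laurent) (val : nat -> nat -> nat -> B) :
  let br a b c := bracket val (@smooth3 D a b c) in
  let wp := weight p in let wq := weight q in let wr := weight r in
  (bracket val D
  = (wp * wq * wr) *: (br p q r + br (turn p) (turn q) r)
    + (wp^-1 * wq * wr) *: br (turn p) q r + (wp * wq^-1 * wr) *: br p (turn q) r
    + (wp * wq * wr^-1) *: br p q (turn r))%R.
Proof.
have [[hp hq hr] _ _ alt _] := site; have [_ _ oE _ _] := gD => br wp wq wr.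
have [fr pl] := conj triangle_frame triangle_placed.
pose x := Marking (@id (dart D)).
have [b bE] : exists b : seq nat -> B, forall js,
    b js = bracket val (marked (smooth_all s3 p x js)) by eexists.
have sk js j := skein_smooth_all fr val (x := x) (js := js) (j := j) pl gD.
have eqv c js1 js2 := equiv_smooth_all fr val (b := c) (x1 := x) (x2 := x)
  (js1 := js1) (js2 := js2) pl gD pl gD.
have e1 : b [:: 1; 4; 9] = b [:: 1; 5; 8].
  have := eqv false [:: 1; 4; 9] [:: 1; 5; 8].
  by rewrite !bE scale1r; apply; vm_compute.
have e2 : b [:: 0; 5; 9] = b [:: 1; 5; 8].
  have := eqv false [:: 0; 5; 9] [:: 1; 5; 8].
  by rewrite !bE scale1r; apply; vm_compute.
have e3 : b [:: 1; 5; 9] = (d_loop *: b [:: 1; 5; 8])%R.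
  by have := eqv true [:: 1; 5; 9] [:: 1; 5; 8]; rewrite !bE expr1; apply; vm_compute.
have s0 : b [::] = (wp *: b [:: 0] + wp^-1 *: b [:: 1])%R.
  by rewrite !bE; apply: (sk [::] 0); vm_compute.
have s1 j : j \in [:: 0; 1] -> b [:: j] = (wq *: b [:: j; 4] + wq^-1 *: b [:: j; 5])%R.
  rewrite !inE !bE => /orP[] /eqP ->; last by apply: (sk [:: 1] 4); vm_compute.
  by apply: (sk [:: 0] 4); vm_compute.
have s2 j k : j \in [:: 0; 1] -> k \in [:: 4; 5] ->
    b [:: j; k] = (wr *: b [:: j; k; 8] + wr^-1 *: b [:: j; k; 9])%R.
  rewrite !inE !bE => /orP[] /eqP -> /orP[] /eqP ->.
  - by apply: (sk [:: 0; 4] 8); vm_compute.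
  - by apply: (sk [:: 0; 5] 8); vm_compute.
  - by apply: (sk [:: 1; 4] 8); vm_compute.
  - by apply: (sk [:: 1; 5] 8); vm_compute.
have -> : br p q r = b [:: 0; 4; 8] by rewrite bE.
have -> : br (turn p) (turn q) r = b [:: 1; 5; 8] by rewrite bE.
have -> : br (turn p) q r = b [:: 1; 4; 8] by rewrite bE.
have -> : br p (turn q) r = b [:: 0; 5; 8] by rewrite bE.
have -> : br p q (turn r) = b [:: 0; 4; 9] by rewrite bE.
have -> : bracket val D = b [::] by rewrite bE.
rewrite s0 !s1 // !s2 // e1 e2 e3; apply: triangle_cancel.
apply: triangle_coefficient; first exact: A_neq0.
  by rewrite /d_loop; move: A => a; rewrite exprVn.
by apply: contra alt; rewrite !oE //; do 3!case: (over _).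
Qed.

End Triangle.

Section R3Move.
Variables (K : odiagram) (p q r : dart K).
Hypotheses (gK : good K) (site : R3_site p q r) (gK' : good (R3 p q r)).

Notation s3 := (triangle_darts p q r).
Notation v := (nth p s3).
Notation idx := (triangle_idx gK site).
Notation sw := (R3_swap p q r).
Notation K' := (R3 p q r).

Definition swap_index := nth 0 [:: 11; 6; 9; 4; 3; 10; 1; 8; 7; 2; 5; 0].

Lemma R3_swap_index k : k < 12 -> sw (v k) = v (swap_index k).
Proof.
pose tp (a b j : nat) := if j == a then b else if j == b then a else j.
have tlt a b j : a < 12 -> b < 12 -> j < 12 -> tp a b j < 12.
  by move=> an bn jn; rewrite /tp; do 2?case: ifP.
have tpE a b j : a < 12 -> b < 12 -> j < 12 ->
    tperm (v a) (v b) (v j) = v (tp a b j).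
  by move=> an bn jn; rewrite permE /= !idx // /tp; do 2?case: ifP.
move=> kn; rewrite /R3_swap !permM.
transitivity (tperm (v 9) (v 2) (tperm (v 11) (v 0) (tperm (v 5) (v 10)
  (tperm (v 7) (v 8) (tperm (v 1) (v 6) (tperm (v 3) (v 4) (v k))))))) => //.
rewrite !tpE ?tlt //.
by do 12?[case: k kn => [|k] kn //].
Qed.

Lemma R3_swap_out x : x \notin s3 -> sw x = x.
Proof.
move=> xs; have nx k : k < 12 -> v k != x.
  by move=> kn; apply: contraNneq xs => <-; apply: mem_nth.
have tp j k : j < 12 -> k < 12 -> tperm (v j) (v k) x = x.
  by move=> jn kn; rewrite tpermD ?nx.
rewrite /R3_swap !permM.
transitivity (tperm (v 9) (v 2) (tperm (v 11) (v 0) (tperm (v 5) (v 10)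
  (tperm (v 7) (v 8) (tperm (v 1) (v 6) (tperm (v 3) (v 4) x)))))) => //.
by rewrite !tp.
Qed.

Lemma triangle_mem x : x \in s3 -> exists2 k, k < 12 & x = v k.
Proof.
move=> xs; exists (index x s3); last by rewrite nth_index.
by rewrite -[12]/(size s3) index_mem.
Qed.

Lemma R3_swapK : involutive sw.
Proof.
move=> x; have [/triangle_mem[k kn ->]|xs] := boolP (x \in s3); last first.
  by rewrite !R3_swap_out.
rewrite R3_swap_index // R3_swap_index; last by do 12?[case: k kn => [|k] kn //].
by congr nth; do 12?[case: k kn => [|k] kn //].
Qed.

Definition R3_region := nth 0 [:: 5; 2; 0; 3; 4; 3; 0; 1; 6; 1; 0; 2].

Notation label := (label (triangle_regions p q r) (inner K)).

Lemma R3_regE (d : dart K) : reg (d : dart K') =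
  let at_vertex x y z e :=
    if d == v x then reg (turn (v y))
    else if d == v x.+1 then reg (turn (turn (v y)))
    else if d == v x.+2 then reg (v x)
    else if d == v x.+3 then reg (turn (turn (v z)))
    else e in
  at_vertex 0 4 8 (at_vertex 4 8 0 (at_vertex 8 0 4 (reg d))).
Proof. by []. Qed.

Lemma R3_reg_out x : x \notin s3 -> reg (x : dart K') = reg (x : dart K).
Proof.
move=> xs; have nx k : k < 12 -> (x == v k) = false.
  by move=> kn; apply: contraNF xs => /eqP ->; apply: mem_nth.
by rewrite R3_regE; cbv beta zeta; rewrite !nx.
Qed.

Lemma R3_reg k : k < 12 -> reg (v k : dart K') = label (R3_region k).
Proof.
move=> kn; have lE := pl_lab (triangle_placed gK site).
rewrite R3_regE; cbv beta zeta; rewrite !idx //.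
do 12?[case: k kn => [|k] kn; first by
  first [exact: (lE 0) | exact: (lE 1) | exact: (lE 2) | exact: (lE 3)
   | exact: (lE 4) | exact: (lE 5) | exact: (lE 6) | exact: (lE 7)
   | exact: (lE 8) | exact: (lE 9) | exact: (lE 10) | exact: (lE 11)]].
by [].
Qed.

(** Read through [sw], the edges of the new diagram are those of [K]; in return its rotation is
    conjugated by the swap, which gives the table for [tau]. *)
Lemma R3_placed : placed s3 triangle_int p (triangle_regions p q r) (inner K)
  (D := K') sw (nth 0 [seq swap_index (spin (swap_index k)) | k <- iota 0 12])
  (fun k => R3_region (swap_index k)) id [::].
Proof.
have swlt k : k < 12 -> swap_index k < 12.
  by move=> kn; do 12?[case: k kn => [|k] kn //].
have spl := pl_tau (triangle_placed gK site).
split=> //.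
- exact: perm_inj.
- by move=> z; exists (sw z); rewrite R3_swapK.
- by move=> x /=; rewrite R3_swapK.
- by move=> x xs /=; rewrite !R3_swap_out // !mem_cat !vertex_turn -?mem_cat.
- by move=> x xs /=; rewrite R3_swap_out.
- move=> k kn; rewrite (nth_map 0) ?size_iota // nth_iota // add0n.
  have [t1 /eqP t2] := andP (spl _ (swlt k kn)).
  by rewrite swlt // (R3_swap_index kn) -(R3_swap_index t1) R3_swapK; apply/eqP.
- move=> x xI; have [xs|xs] := boolP (x \in s3); last first.
    by rewrite R3_swap_out // R3_reg_out.
  have [k kn xE] := triangle_mem xs; rewrite xE R3_swap_index // R3_reg ?swlt //.
  rewrite -[RHS]/(reg (id (v k))) (pl_lab (triangle_placed gK site)) //.
  congr label.
  have : (k \in triangle_int) || (R3_region (swap_index k) == triangle_label k).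
    by move: kn {xE}; do 12?[case: k => [|k] //].
  by case/orP=> [kI|/eqP //]; case/negP: xI; rewrite xE inE map_f.
- by move=> k kn; rewrite R3_swap_index // R3_reg ?swlt.
- by move=> U h _; exists h.
Qed.

(* The move is symmetric: its result has a triangle at the opposite corners. *)
Lemma R3_site_back :
  R3_site (D := K') (turn (turn p)) (turn (turn q)) (turn (turn r)).
Proof.
have [[hp hq hr] [qp rp rq] [e1 e2 e3] alt [emp ip op]] := site.
have [eK _ oE _ _] := gK.
have mem_opp (c d : dart K) :
    (turn (turn d) \in vertex (turn (turn c))) = (d \in vertex c).
  have sym (a b : dart K) : (a \in vertex b) = (b \in vertex a).
    exact: (Skein.orb_sym (turn4 gK) b a).
  by rewrite !vertex_turn // sym !vertex_turn // sym.
have opE (c : dart K) : crossing c -> over (turn (turn (turn c))) = over (turn c).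
  by move=> hc; rewrite !oE ?crossing_turn // negbK.
have e k j : k < 12 -> j < 12 -> edge (v (swap_index k)) = v (swap_index j) ->
    edge (v k : dart K') = v j.
  move=> kn jn ekj; rewrite /= R3_swap_index // ekj -R3_swap_index //.
  exact: R3_swapK.
have lab0 k : (label k == reg p) = (k == 0).
  case: k => [|k]; first exact: eqxx.
  exact/negbTE/(fr_label (triangle_frame gK site)).
have rp2 : reg (turn (turn p) : dart K') = reg p by rewrite (@R3_reg 2).
have hx (c : dart K) : crossing c -> @crossing K' (turn (turn c)).
  by move=> hc; rewrite -[@crossing K' _]/(@crossing K (turn (turn c))) !crossing_turn.
split=> //.
- by split; apply: hx.
- by split; rewrite [_ \in _]mem_opp.
- split; [apply: (e 3 6) | apply: (e 7 10) | apply: (e 11 2)] => //=.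
  + by rewrite -[in LHS]e1 eK.
  + by rewrite -[in LHS]e2 eK.
  + by rewrite -[in LHS]e3 eK.
- by rewrite /= !opE.
- split=> //; rewrite rp2 // => d.
  have [/triangle_mem[k kn ->]|ds] := boolP (d \in s3).
    rewrite R3_reg // lab0 !inE.
    rewrite -[turn (turn p)]/(v 2) -[turn (turn q)]/(v 6) -[turn (turn r)]/(v 10).
    by rewrite !idx //; do 12?[case: k kn => [|k] kn //].
  have ne k : k < 12 -> (d == v k) = false.
    by move=> kn; apply: contraNF ds => /eqP ->; apply: mem_nth.
  rewrite R3_reg_out // emp !inE (ne 0 isT : (d == p) = false).
  rewrite (ne 4 isT : (d == q) = false) (ne 8 isT : (d == r) = false).
  rewrite (ne 2 isT : (d == turn (turn p)) = false).
  rewrite (ne 6 isT : (d == turn (turn q)) = false).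
  by rewrite (ne 10 isT : (d == turn (turn r)) = false).
Qed.

(* The move exchanges the states in which no corner, respectively two corners, of
   the triangle are cut off, and preserves those in which one corner is. *)
Lemma R3_bracket (B : lmodType Laurent) (val : nat -> nat -> nat -> B) :
  bracket val K = bracket val K'.
Proof.
have fr := triangle_frame gK site; have pl := triangle_placed gK site.
have [[hp hq hr] _ _ _ _] := site; have [_ _ oE _ _] := gK.
have eqv js1 js2 := equiv_smooth_all fr val (b := false) (x1 := Marking (@id (dart K)))
  (x2 := @Marking K K' sw) (js1 := js1) (js2 := js2) pl gK R3_placed gK'.
pose br := (fun a b c : dart K => bracket val (smooth3 a b c)).
pose br' := (fun a b c : dart K => bracket val (@smooth3 K' a b c)).
have st i j k i' j' k' : i' < 12 -> j' < 12 -> k' < 12 ->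
  bracket val (marked (smooth_all s3 p (Marking (@id (dart K))) [:: i; j; k]))
  = (d_loop ^+ false *: bracket val
      (marked (smooth_all s3 p (@Marking K K' sw) [:: i'; j'; k'])))%R ->
  br (v i) (v j) (v k)
  = br' (v (swap_index i')) (v (swap_index j')) (v (swap_index k')).
  move=> in' jn' kn' h; rewrite -!R3_swap_index //.
  by move: h; rewrite scale1r.
(* The indices on the side of [K'] are preimages under [swap_index]: the new corners [v 2], [v 6],
   [v 10] come from 9, 1, 5, and their rotations [v 3], [v 7], [v 11] from 4, 8, 0. *)
have e0 : br p q r = br' (v 3) (v 7) (v 10).
  by apply: (st 0 4 8 4 8 5) => //; apply: (eqv [:: 0; 4; 8] [:: 4; 8; 5]); vm_compute.
have e1 : br (v 1) (v 5) r = br' (v 2) (v 6) (v 10).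
  by apply: (st 1 5 8 9 1 5) => //; apply: (eqv [:: 1; 5; 8] [:: 9; 1; 5]); vm_compute.
have e2 : br (v 1) q r = br' (v 3) (v 6) (v 10).
  by apply: (st 1 4 8 4 1 5) => //; apply: (eqv [:: 1; 4; 8] [:: 4; 1; 5]); vm_compute.
have e3 : br p (v 5) r = br' (v 2) (v 7) (v 10).
  by apply: (st 0 5 8 9 8 5) => //; apply: (eqv [:: 0; 5; 8] [:: 9; 8; 5]); vm_compute.
have e4 : br p q (v 9) = br' (v 2) (v 6) (v 11).
  by apply: (st 0 4 9 9 1 0) => //; apply: (eqv [:: 0; 4; 9] [:: 9; 1; 0]); vm_compute.
(* Opposite darts belong to the same strand, so the expansion of the new triangle has the same
   weights. *)
have w (c : dart K) : crossing c ->
    weight (D := K') (turn (turn c)) = weight (D := K) c.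
  by move=> hc; rewrite /weight /= !oE ?crossing_turn // negbK.
rewrite (triangle_bracket gK site) (triangle_bracket gK' R3_site_back).
rewrite !w // -!/(br _ _ _) -!/(br' _ _ _).
rewrite e0 e1 e2 e3 e4 [(br' (v 3) _ _ + _)%R]addrC.
by [].
Qed.

End R3Move.

Local Close Scope nat_scope.

(** * Writhe and invariance *)

Definition crossing_sign (K : odiagram) (c : dart K) : int :=
  if fwd (turn c) then 1 else - 1.

Lemma writhe_split (K : odiagram) (V : seq (dart K)) : uniq V ->
  writhe K
  = \sum_(c <- V | [&& crossing c, over c & fwd c]) crossing_sign c
    + \sum_(c | [&& crossing c, over c & fwd c] && (c \notin V)) crossing_sign c.
Proof.
move=> uV; rewrite /writhe (bigID (fun c => c \in V)) /=; congr (_ + _).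
rewrite [RHS]big_mkcond big_uniq //= -big_mkcondr.
by apply: eq_bigl => c; rewrite andbC.
Qed.

Section MoveWrithe.
Variable K : odiagram.
Hypothesis oK : oriented_annular K.

Let gK : good K. Proof. by case: oK => /annular_good. Qed.

Let fwd_edge (d : dart K) : fwd (edge d) = ~~ fwd d. Proof. by case: oK. Qed.

Let fwd_opp (d : dart K) : crossing d -> fwd (turn (turn d)) = ~~ fwd d.
Proof.
move=> hd; have [_ _ /(_ d)] := oK; rewrite /straight hd; apply.
by apply: contra hd => /eqP h; rewrite !h.
Qed.

Let over_turn (d : dart K) : crossing d -> over (turn d) = ~~ over d.
Proof. by case: gK => _ _ oE _ _; apply: oE. Qed.

Let hturn (d : dart K) : crossing (turn d) = crossing d.
Proof. exact: crossing_turn. Qed.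

(** The loop leaves by one of [l] and [turn l] and returns by the other, so the sign of the kink
    does not depend on the orientation. *)
Lemma writhe_R1 (l : dart K) : R1_site l ->
  writhe K = writhe (R1 l) + (if over l then - 1 else 1).
Proof.
case=> hl el _; rewrite (writhe_split (vertex_uniq gK hl)) addrC.
rewrite [writhe (R1 l)](writhe_split (K := R1 l) (vertex_uniq gK hl)).
rewrite [X in _ = X + _ + _]big1_seq ?add0r; last first.
  by move=> c /andP[/andP[]]; rewrite /crossing /= => hc _ cV; move: hc;
    rewrite cV !vertex_turn // cV turn4 // eqxx.
congr (_ + _).
  apply: eq_big => [c|c /andP[_ cV]]; last by rewrite /crossing_sign /= (negPf cV).
  rewrite /crossing /=; case cV: (c \in vertex l); rewrite ?andbF //.
  by rewrite vertex_turn // cV.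
rewrite !big_cons big_nil /= !hturn hl /crossing_sign turn4 //.
rewrite !over_turn ?hturn // !(fwd_opp hl) !(@fwd_opp (turn l)) ?hturn // -el fwd_edge.
by case: (over l); case: (fwd l); rewrite /= ?addr0.
Qed.

(** One strand is over at both crossings, and the edges of the bigon carry the orientations from one
    crossing to the other; this forces opposite signs. *)
Lemma writhe_R2 (p q : dart K) : R2_site p q -> writhe K = writhe (R2 p q).
Proof.
case=> [[hp hq qp] ep eq opq _]; have uV := vertex_cat_uniq gK hp hq qp.
have tV (d : dart K) :
    (turn d \in vertex p ++ vertex q) = (d \in vertex p ++ vertex q).
  by rewrite !mem_cat !vertex_turn.
rewrite (writhe_split uV) [RHS](writhe_split (K := R2 p q) uV).
rewrite [X in _ = X + _]big1_seq ?add0r; last first.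
  move=> c /andP[/andP[]]; rewrite /crossing /= => hc _ cV; move: hc.
  by rewrite cV !tV cV turn4 // eqxx.
rewrite -[RHS]add0r; congr (_ + _); last first.
  apply: eq_big => [c|c /andP[_ cV]]; last by rewrite /crossing_sign /= (negPf cV).
  rewrite /crossing /=; case cV: (c \in vertex p ++ vertex q); rewrite ?andbF //.
  by rewrite tV cV.
have fq : fwd q = ~~ fwd (turn p) by rewrite -ep fwd_edge.
have fp : fwd p = ~~ fwd (turn q) by rewrite -eq fwd_edge.
rewrite big_cat /= !big_cons !big_nil /= !hturn hp hq /crossing_sign !turn4 //.
rewrite !over_turn ?hturn // !(fwd_opp hp) !(fwd_opp hq).
rewrite !(@fwd_opp (turn p)) ?hturn // !(@fwd_opp (turn q)) ?hturn //.
rewrite opq over_turn // fq fp.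
by case: (over q); case: (fwd (turn q)); case: (fwd (turn p)).
Qed.

End MoveWrithe.

Section Invariance.
Variables (B : lmodType Laurent) (val : nat -> nat -> nat -> B).

Definition normalized (K : odiagram) : B :=
  ((- A ^+ 3) ^ (- writhe K)) *: bracket val K.

(** In both cases the left side is [- w ^- 3]. *)
Lemma kink_factor (F : fieldType) (a d : F) (b : bool) :
  let w := if b then a else a^-1 in
  a != 0 -> d = - a ^+ 2 - a ^- 2 ->
  w + w^-1 * d = (- a ^+ 3) ^ (if b then - 1 else 1 : int).
Proof.
move=> w a0 ->; rewrite {}/w; case: b; rewrite ?expr1z ?exprN1 ?invrK;
  by field; rewrite ?oppr_eq0 ?expf_neq0 ?a0 ?oner_eq0.
Qed.

Lemma normalized_move (K K' : odiagram) : oriented_annular K ->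
  oriented_annular K' -> move K K' -> normalized K = normalized K'.
Proof.
move=> oK oK' mv; have [[aK _ _] [aK' _ _]] := (oK, oK').
have [gK gK'] := (annular_good aK, annular_good aK').
case: mv oK' aK' gK' => {K'}.
- move=> K' iso _ aK' gK'; rewrite /normalized (writhe_isomorphic iso).
  by rewrite (local_equiv_bracket val (isomorphic_equiv aK aK' iso)) scale1r.
- move=> a _ aK' gK'; rewrite /normalized writhe_subdivide.
  by rewrite (local_equiv_bracket val (subdivide_equiv aK aK')) scale1r.
- move=> l site _ _ gK'; rewrite /normalized (writhe_R1 oK site).
  rewrite (R1_bracket gK site val gK') scalerA; congr (_ *: _).
  rewrite /weight (kink_factor (over l) A_neq0 erefl).
  have x0 : - A ^+ 3 != 0 by rewrite oppr_eq0 expf_neq0 // A_neq0.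
  by rewrite -expfzDr // opprD addrNK.
- move=> p q site _ _ gK'; rewrite /normalized (writhe_R2 oK site).
  by rewrite (R2_bracket gK site val gK').
(* The move alters [edge] and [reg] only, so both writhes agree by computation. *)
- move=> p q r site _ _ gK'; rewrite /normalized.
  by rewrite (R3_bracket gK site gK' val).
Qed.

Lemma normalized_equivalent (K K' : odiagram) :
  annular_equivalent K K' -> normalized K = normalized K'.
Proof.
elim=> {K K'} [K K' [oK oK' mv]|K|K K' _ ->|K1 K2 K3 _ -> _ ->] //.
exact: normalized_move.
Qed.

End Invariance.

Theorem theorem3p10 (K K' : odiagram)
    (hK : oriented_annular K) (hK' : oriented_annular K') :
  annular_equivalent K K' ->
  jones K = jones K' /\ universal_jones K = universal_jones K'.
Proof.
by move=> eqK; split; apply: normalized_equivalent eqK.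
Qed.
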